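(* Let $V$ be a finite ground set of $n$ items partitioned into $m$ groups $V_1,\dots,V_m$, let $k_i=|V_i|$ and $k_{\min}=\min_{i\in[m]}k_i$, let $\alpha$ be a nonnegative integer, and let $f:2^V\to\mathbb{R}_{\ge 0}$ be a (not necessarily monotone) submodular function. Let $OPT$ be an optimal solution of Problem P.0: maximize $f(S)$ over $S\subseteq V$ subject to $|S\cap V_i|-|S\cap V_j|\le\alpha$ for all $i,j\in[m]$. Suppose $k_{\min}>1$ and the algorithm SG (described in the context) is run with sampling probability $p=\frac{\sqrt5-1}{4}$. Then its output satisfies $$\mathbb{E}[f(A^{\mathsf{final}})]\ge 0.045\cdot f(OPT),$$ where the expectation is over the random set $R$ sampled by the algorithm.
   Context: For $X,Y\subseteq V$, $f(X\mid Y)=f(X\cup Y)-f(Y)$; $f$ is submodular if $f(e\mid Y)\le f(e\mid X)$ whenever $X\subseteq Y\subseteq V$ and $e\in V\setminus Y$. For each $i\in[m]$ let $r_i=\min\{\lfloor k_i/2\rfloor,\lfloor k_{\min}/2\rfloor+\alpha\}$. A set $S\subseteq V$ is called semi-feasible if $|S\cap V_i|\le r_i$ for all $i\in[m]$. Algorithm SG with parameter $p\in[0,1]$: (1) Sample a random set $R\subseteq V$ containing each item independently with probability $p$. (2) Greedy phase: start with $A=\emptyset$; repeatedly let $e'$ be an item maximizing $f(e\mid A)$ over all $e\in R\setminus A$ such that $A\cup\{e\}$ is semi-feasible (ties broken arbitrarily); if such $e'$ exists and $f(e'\mid A)>0$, add $e'$ to $A$, otherwise stop. Call the resulting set $A^{\mathsf{greedy}}$.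 (3) Completion phase: let $L=\{i\in[m]: |A^{\mathsf{greedy}}\cap V_i|<r_i\}$. For each $i\in L$ choose arbitrary disjoint sets $X_i,Y_i\subseteq V_i\setminus A^{\mathsf{greedy}}$ with $|X_i|=|Y_i|=r_i-|A^{\mathsf{greedy}}\cap V_i|$ (such sets always exist). Let $A^1=A^{\mathsf{greedy}}\cup\bigcup_{i\in L}X_i$, $A^2=A^{\mathsf{greedy}}\cup\bigcup_{i\in L}Y_i$, and output $A^{\mathsf{final}}$, the one of $A^1,A^2$ with larger $f$-value. *)

(* Defs.v *)
From mathcomp Require Import all_boot all_order all_algebra.
Set Implicit Arguments. Unset Strict Implicit. Unset Printing Implicit Defensive.
Import Order.TTheory GRing.Theory Num.Theory.
Local Open Scope ring_scope.

Section SG.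
Variables (R : rcfType) (V : finType) (m : nat) (g : V -> 'I_m)
          (alpha : nat) (f : {set V} -> R).

Definition grp (i : 'I_m) : {set V} := [set v | g v == i].
Definition ksz (i : 'I_m) : nat := #|grp i|.
(* k_min = min_i k_i  (meaningful when m > 0; every k_i <= |V|) *)
Definition kmin : nat := \big[minn/#|V|]_(i < m) ksz i.
Definition rcap (i : 'I_m) : nat := minn (ksz i)./2 (kmin./2 + alpha).

Definition marg (e : V) (A : {set V}) : R := f (e |: A) - f A.

Definition submodular : Prop :=
  forall X Y : {set V}, X \subset Y -> forall e, e \notin Y ->
    f (e |: Y) - f Y <= f (e |: X) - f X.

Definition nonneg : Prop := forall S, 0 <= f S.

Definition feasible (S : {set V}) : Prop :=
  forall i j : 'I_m, (#|S :&: grp i|%:Z - #|S :&: grp j|%:Z <= alpha%:Z)%R.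

Definition semi_feasible (S : {set V}) : Prop :=
  forall i : 'I_m, (#|S :&: grp i| <= rcap i)%N.

Definition greedy_step (Rs A : {set V}) (e : V) : Prop :=
  [/\ e \in Rs :\: A, semi_feasible (e |: A),
      (forall e', e' \in Rs :\: A -> semi_feasible (e' |: A) -> marg e' A <= marg e A)
    & 0 < marg e A].

Definition greedy_stop (Rs A : {set V}) : Prop :=
  forall e', e' \in Rs :\: A -> semi_feasible (e' |: A) -> marg e' A <= 0.

Inductive greedy_run (Rs : {set V}) : {set V} -> Prop :=
| greedy_nil : greedy_run Rs set0
| greedy_cons A e : greedy_run Rs A -> greedy_step Rs A e -> greedy_run Rs (e |: A).

(* A is a possible A^greedy on sample Rs (for some tie-breaking) *)
Definition greedy_out (Rs A : {set V}) : Prop := greedy_run Rs A /\ greedy_stop Rs A.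

(* A is a possible A^final of SG on sample Rs (for some tie-breaking and
   some choice of the completion sets X_i, Y_i) *)
Definition SG_out (Rs Af : {set V}) : Prop :=
  exists Ag (X Y : 'I_m -> {set V}),
    [/\ greedy_out Rs Ag,
        (forall i, (#|Ag :&: grp i| < rcap i)%N ->
           [/\ X i \subset grp i :\: Ag, Y i \subset grp i :\: Ag,
               [disjoint X i & Y i],
               #|X i| = (rcap i - #|Ag :&: grp i|)%N &
               #|Y i| = (rcap i - #|Ag :&: grp i|)%N]) &
        let A1 := Ag :|: \bigcup_(i | (#|Ag :&: grp i| < rcap i)%N) X i in
        let A2 := Ag :|: \bigcup_(i | (#|Ag :&: grp i| < rcap i)%N) Y i in
        (Af = A1 /\ f A2 <= f A1) \/ (Af = A2 /\ f A1 <= f A2)].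

Definition expect_sample (p : R) (h : {set V} -> R) : R :=
  \sum_(Rs : {set V}) p ^+ #|Rs| * (1 - p) ^+ (#|V| - #|Rs|) * h Rs.

End SG.

(* Main.v *)
(* Ties may be broken depending on the sample, so the runs on a sample with and
   without a given item cannot be compared, and the classical analysis of sampled
   greedy does not apply. Instead, three samples are coupled.

   Let O = OPT and let r_i be the capacity of group i. Feasibility gives
   |O \cap V_i| <= 3 r_i, so O \cap V_i splits into r_i slots of at most three
   items. Fix the part W of the sample outside O, and draw three p-samples S_k of O
   with selections T_k \subset S_k such that each slot contributes at most one item
   to each T_k, nothing to at least one of them, and each item of O belongs to each
   T_k with probability 2/9, disjointly. Let A_k be the greedy output on W \cup S_k.
   An item sampled but rejected by greedy has marginal at most the least price of
   its group, so adding T_k to A_k costs at most one price per nonempty slot;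
   and the picks of A_3 outside O lie in W, hence were available to A_1 and A_2 too,
   so they can be charged to the run whose selection is empty in the slot.
   Picks of A_k inside O belong to T_k with probability at least 0.33, which saves
   their cost. Altogether
     E f(A_1 \cup A_2 \cup A_3 \cup T_1 \cup T_2 \cup T_3) <= 5.01 E f(A).
   The left-hand side is at least (2/3) min_(Z \subset W) f(O \cup Z): partial
   minimisation over Z preserves submodularity, and every item of O is covered with
   probability at least 2/3. As the minimiser Z contains each item with probability
   at most p, averaging over W gives E f(A) >= (2/3) (1 - p) f(O) / 5.01, and the
   completion phase loses at most a factor 2. *)
Require Import Defs.
From HB Require Import structures.
From mathcomp Require Import all_boot all_order all_algebra all_fingroup.
From mathcomp Require Import lra ring zify.
Import Order.TTheory GRing.Theory Num.Theory.
Local Open Scope ring_scope.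
Set Implicit Arguments. Unset Strict Implicit. Unset Printing Implicit Defensive.

(** * Submodular functions and greedy runs *)

Section Submodular.
Variables (R : rcfType) (V : finType) (f : {set V} -> R).

Lemma marg_in (e : V) (A : {set V}) : e \in A -> marg f e A = 0.
Proof. by move=> eA; rewrite /marg (setUidPr _) ?sub1set // subrr. Qed.

Hypothesis fsub : submodular f.

Lemma marg_anti (A B : {set V}) e :
  A \subset B -> e \notin B -> marg f e B <= marg f e A.
Proof. by move=> AB eB; apply: fsub. Qed.

(** The items of [T] are added to [B] one at a time. Marginals are taken at the smaller set [A],
    because prices refer to a single run while [B] will be a union of runs. *)
Lemma gain_le_sum_marg (A B T : {set V}) :
  A \subset B -> f (B :|: T) - f B <= \sum_(v in T :\: B) marg f v A.
Proof.
move=> sAB; have [n] := ubnP #|T :\: B|; elim: n T B sAB => // n IH T B sAB leT.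
have [T0|[v vT]] := set_0Vmem (T :\: B).
  rewrite T0 big_set0.
  suff -> : B :|: T = B by rewrite subrr.
  by apply/setUidPl; rewrite -setD_eq0 T0.
have eT : T :\: (v |: B) = (T :\: B) :\ v by rewrite setDDl setUC.
have := IH T (v |: B) (subset_trans sAB (subsetUr _ _)).
rewrite eT => /(_ _); move: leT; rewrite (cardsD1 v) vT add1n ltnS => leT /(_ leT) h.
rewrite (big_setD1 v vT) /=.
have -> : B :|: T = v |: B :|: T.
  apply/setP=> x; rewrite !inE; case: eqP => // ->.
  by move: vT; rewrite inE => /andP[_ ->]; rewrite orbT.
have vnB : v \notin B by move: vT; rewrite inE => /andP[].
have := marg_anti sAB vnB.
by rewrite /marg in h *; lra.
Qed.

Lemma submodularUI (A B : {set V}) :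
  f (A :|: B) + f (A :&: B) <= f A + f B.
Proof.
have [n] := ubnP #|B :\: A|; elim: n A B => // n IH A B leB.
have [B0|[v vB]] := set_0Vmem (B :\: A).
  have sBA : B \subset A by rewrite -setD_eq0 B0.
  by rewrite (setUidPl sBA) (setIidPr sBA).
have [vnA vinB] : v \notin A /\ v \in B by move: vB; rewrite inE => /andP[].
have cB : (#|B :\ v :\: A| < n)%N.
  move: leB; rewrite (cardsD1 v) vB add1n ltnS; congr (_ < _)%N.
  by rewrite !setDDl setUC.
have := IH A (B :\ v) cB.
have -> : A :&: (B :\ v) = A :&: B.
  by apply/setP=> x; rewrite !inE; case: eqP => // ->; rewrite (negbTE vnA).
have := @fsub (B :\ v) (A :|: B :\ v) (subsetUr _ _) v.
rewrite !inE (negbTE vnA) eqxx /= => /(_ isT).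
rewrite setD1K //.
have -> : v |: (A :|: B :\ v) = A :|: B by rewrite setUCA setD1K.
by move=> *; lra.
Qed.

End Submodular.

(** * Prices of greedy picks and of rejected items *)

Section Greedy.
Variables (R : rcfType) (V : finType) (m : nat) (g : V -> 'I_m).
Variables (alpha : nat) (f : {set V} -> R).
Hypothesis fsub : submodular f.

(** [d a] is the gain of [a] when picked. If [A] is added to [B] in the order of picking, each step
    gains at most [d a] and at most [marg f a B], both by submodularity. *)
Lemma greedy_run_prices (Rs A : {set V}) : greedy_run g alpha f Rs A ->
  [/\ A \subset Rs, semi_feasible g alpha A &
    exists d : V -> R,
    [/\ forall a, 0 <= d a,
        f A = f set0 + \sum_(a in A) d a,
        forall B, f (B :|: A) - f B <= \sum_(a in A) Num.min (d a) (marg f a B)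
      & forall e, e \in Rs :\: A -> forall a, a \in A -> g a = g e ->
          marg f e A <= d a]].
Proof.
elim=> [|A' e _ [sAR sfA [d [d0 fA chainA maxA]]] [eRA sfeA maxe mege0]].
  split; first exact: sub0set.
    by move=> i; rewrite set0I cards0.
  exists (fun _ => 0); split=> //.
  - by rewrite big_set0 addr0.
  - by move=> B; rewrite big_set0 setU0 subrr.
  - by move=> e _ a; rewrite inE.
move: eRA; rewrite inE => /andP[enA eR].
split=> //.
  by rewrite subUset sub1set eR.
exists (fun v => if v == e then marg f e A' else d v).
have dA (F : V -> R -> R) : \sum_(a in A') F a (if a == e then marg f e A' else d a) =
    \sum_(a in A') F a (d a).
  by apply: eq_bigr => a aA; case: eqP => // ae; rewrite -ae aA in enA.
split.
- by move=> a; case: eqP => // _; apply: ltW.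
- rewrite big_setU1 //= eqxx (dA (fun _ x => x)) /marg; lra.
- move=> B; rewrite big_setU1 //= eqxx (dA (fun a x => Num.min x (marg f a B))).
  have := chainA B.
  suff : f (B :|: (e |: A')) - f (B :|: A') <= Num.min (marg f e A') (marg f e B).
    by move=> *; lra.
  rewrite setUCA; have [eB|eB] := boolP (e \in B).
    rewrite (setUidPr _) ?sub1set ?inE ?eB // subrr le_min (marg_in _ eB) lexx andbT ltW //.
  have eBA : e \notin B :|: A' by rewrite inE negb_or eB.
  rewrite le_min; apply/andP; split; apply: fsub => //.
    exact: subsetUr.
  exact: subsetUl.
- move=> e'; rewrite !inE negb_or -andbA => /and3P[e'e e'A e'R] a.
  have le' : marg f e' (e |: A') <= marg f e' A'.
    by apply: fsub; rewrite ?subsetUr // !inE negb_or e'e.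
  rewrite !inE => /orP[/eqP-> ge|aA gae].
    (* A rival [e'] from the group of the new pick [e] was admissible when [e] was chosen, since
       adding either one gives the same group sizes. *)
    rewrite eqxx; apply: le_trans le' _; apply: maxe; first by rewrite inE e'A.
    move=> i; move: (sfeA i); rewrite !setIUl.
    have sI x : [set x] :&: grp g i = if g x == i then [set x] else set0.
      apply/setP=> y; rewrite !inE.
      by case: (altP (y =P x)) => [->|yx]; case: ifP; rewrite ?inE ?eqxx ?(negbTE yx).
    rewrite !sI ge; case: ifP => // _.
    rewrite !cardsU1 !inE (negbTE enA) (negbTE e'A) //.
  case: eqP => [ae|_]; first by rewrite -ae aA in enA.
  by apply: le_trans le' _; apply: maxA => //; rewrite inE e'A.
Qed.

(** An unpicked item whose group has room can still be added, as the other groups are unaffected, so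
    the stopping rule bounds its marginal by 0. *)
Lemma greedy_out_prices (Rs A : {set V}) : greedy_out g alpha f Rs A ->
  [/\ A \subset Rs, semi_feasible g alpha A &
    exists d : V -> R,
    [/\ forall a, 0 <= d a,
        f A = f set0 + \sum_(a in A) d a,
        forall B, f (B :|: A) - f B <= \sum_(a in A) Num.min (d a) (marg f a B)
      & forall e, e \in Rs :\: A ->
          (forall a, a \in A -> g a = g e -> marg f e A <= d a) /\
          ((#|A :&: grp g (g e)| < rcap g alpha (g e))%N -> marg f e A <= 0)]].
Proof.
case=> /greedy_run_prices[sAR sfA [d [d0 fA chainA maxA]]] stop; split=> //.
exists d; split=> // e eRA; split; first exact: maxA.
move=> lt; apply: stop => // i; rewrite setIUl; move: eRA; rewrite inE => /andP[enA _].
have [gei|gei] := eqVneq (g e) i.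
  have -> : [set e] :&: grp g i = [set e] by apply/setIidPl; rewrite sub1set inE gei.
  by rewrite cardsU1 inE (negbTE enA) -gei.
rewrite (_ : [set e] :&: _ = set0) ?set0U //.
by apply/setP=> x; rewrite !inE; case: eqP => //= ->; rewrite (negbTE gei).
Qed.

End Greedy.

(** * Expectation of a submodular function of a random set *)

Section Sampling.
Variables (R : rcfType) (V : finType).

(** For [B] empty and [s] listing all items by decreasing [q], this is the Lovász extension of [f]
    at [q], less [f set0]. *)
Fixpoint weighted_gains (f : {set V} -> R) (q : V -> R) (B : {set V}) (s : seq V) : R :=
  if s is v :: s' then q v * marg f v B + weighted_gains f q (v |: B) s' else 0.

Lemma weighted_gains_indic (f : {set V} -> R) (Z B C : {set V}) (s : seq V) :
  submodular f -> C \subset B -> uniq s -> all [predC B] s ->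
  weighted_gains f (fun v => (v \in Z)%:R) B s <= f (C :|: [set v in s] :&: Z) - f C.
Proof.
move=> fsub; elim: s B C => [|v s IH] B C sCB.
  move=> _ _ /=; rewrite (_ : [set v in [::]] = set0); last by apply/setP=> x; rewrite !inE.
  by rewrite set0I setU0 subrr.
rewrite /= => /andP[vs us] /andP[vB sB].
have sB' : all [predC v |: B] s.
  apply/allP=> x xs; have /= := allP sB x xs; rewrite !inE negb_or => ->.
  by rewrite andbT; apply: contraNneq vs => <-.
have [vZ|vZ] := boolP (v \in Z).
  have := IH (v |: B) (v |: C) (setUS _ sCB) us sB'.
  have -> : v |: C :|: [set v0 in s] :&: Z = C :|: [set v0 in v :: s] :&: Z.
    by apply/setP=> x; rewrite !inE; case: (eqVneq x v) => //= ->; rewrite vZ orbT.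
  have := marg_anti fsub sCB vB; rewrite /marg mul1r; lra.
have := IH (v |: B) C (subset_trans sCB (subsetUr _ _)) us sB'.
have -> : C :|: [set v0 in s] :&: Z = C :|: [set v0 in v :: s] :&: Z.
  by apply/setP=> x; rewrite !inE; case: (eqVneq x v) => //= ->; rewrite (negbTE vZ) !andbF.
by rewrite mul0r add0r.
Qed.

(** Abel summation: as [q] decreases along [s], every value of [f] except [f B] gets a nonnegative
    coefficient, and [f B] gets at least [- p]. The induction replaces [p] by [q v]. *)
Lemma weighted_gains_sorted (f : {set V} -> R) (q : V -> R) (p : R) B s :
  nonneg f -> 0 <= p -> (forall v, v \in s -> q v <= p) -> sorted (fun u v => q v <= q u) s ->
  (forall v, 0 <= q v) ->
  - (p * f B) <= weighted_gains f q B s.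
Proof.
move=> f0; elim: s p B => [|v s IH] p B p0 qp srt q0 /=.
  by rewrite oppr_le0 mulr_ge0.
have sP : {in s, forall u, q u <= q v}.
  move: srt => /=; rewrite path_sortedE; last by move=> x y z xy /le_trans; apply.
  by case/andP=> /allP.
have srt' : sorted (fun u v => q v <= q u) s by apply: path_sorted srt.
have := IH (q v) (v |: B) (q0 v) sP srt' q0.
have := qp v (mem_head _ _); have := f0 B; rewrite /marg; nra.
Qed.

Section Expectation.
Variables (Om : finType) (mu : Om -> R).
Hypotheses (mu0 : forall w, 0 <= mu w) (mu1 : \sum_w mu w = 1).

Lemma weighted_gains_expect (f : {set V} -> R) (Z : Om -> {set V}) B s :
  \sum_w mu w * weighted_gains f (fun v => (v \in Z w)%:R) B s =
  weighted_gains f (fun v => \sum_(w | v \in Z w) mu w) B s.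
Proof.
elim: s B => [|v s IH] B /=; first by rewrite big1 // => w _; rewrite mulr0.
rewrite -IH big_distrl /= (big_mkcond (fun w => v \in Z w)) -big_split /=.
by apply: eq_bigr => w _; case: (v \in Z w) => /=; rewrite mulrDr ?mul1r ?mul0r ?mulr0.
Qed.

(** Items are ordered by decreasing probability of lying in [Z]. For each outcome, the gains
    weighted by the indicator of [Z w] bound [f (Z w) - f set0] from below; they are linear in the
    weights, so averaging turns indicators into probabilities, whatever the dependence between
    items. *)
Lemma random_set_avoids (f : {set V} -> R) (Z : Om -> {set V}) (p : R) :
  submodular f -> nonneg f -> 0 <= p ->
  (forall v, \sum_(w | v \in Z w) mu w <= p) ->
  (1 - p) * f set0 <= \sum_w mu w * f (Z w).
Proof.
move=> fsub f0 p0 Zp; pose q v := \sum_(w | v \in Z w) mu w.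
pose s := sort (fun u v => q v <= q u) (enum V).
have us : uniq s by rewrite sort_uniq enum_uniq.
have srt : sorted (fun u v => q v <= q u) s by apply: sort_sorted => u v; apply: le_total.
have q0 v : 0 <= q v by apply: sumr_ge0.
have lo : - (p * f set0) <= weighted_gains f q set0 s.
  by apply: weighted_gains_sorted => // v _; apply: Zp.
have sB : all [predC (set0 : {set V})] s by apply/allP => v _; rewrite /= inE.
have up w : weighted_gains f (fun v => (v \in Z w)%:R) set0 s <= f (Z w) - f set0.
  have := weighted_gains_indic (Z w) fsub (sub0set set0) us sB.
  rewrite set0U (_ : [set v in s] = setT) ?setTI //.
  by apply/setP=> v; rewrite !inE mem_sort mem_enum.
have : \sum_w mu w * weighted_gains f (fun v => (v \in Z w)%:R) set0 s <=
       \sum_w (mu w * f (Z w) - mu w * f set0).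
  by apply: ler_sum => w _; rewrite -mulrBr ler_wpM2l.
rewrite weighted_gains_expect sumrB -mulr_suml mu1 mul1r -/q; lra.
Qed.

(** By complementation in [O]: [random_set_avoids] is applied to [h] and the random set [O :\: Z w],
    which contains each item with probability at most [1 - q]. *)
Lemma random_set_covers (f : {set V} -> R) (Z : Om -> {set V}) (O : {set V}) (q : R) :
  submodular f -> nonneg f -> q <= 1 ->
  (forall w, Z w \subset O) ->
  (forall v, v \in O -> q <= \sum_(w | v \in Z w) mu w) ->
  q * f O <= \sum_w mu w * f (Z w).
Proof.
move=> fsub f0 q1 sZO Zq; pose h S := f (O :\: S).
have hsub : submodular h.
  move=> X Y sXY e eY; rewrite /h.
  have DU (S : {set V}) : O :\: (e |: S) = (O :\: S) :\ e by rewrite setDDl setUC.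
  rewrite !DU; have [eO|eO] := boolP (e \in O); last first.
    have nD (S : {set V}) : (O :\: S) :\ e = O :\: S.
      by apply/setP=> x; rewrite !inE; case: eqP => // ->; rewrite (negbTE eO) andbF.
    by rewrite !nD !subrr.
  have eX : e \notin X by apply: contraNN eY; apply: (subsetP sXY).
  have := @fsub (O :\: Y :\ e) (O :\: X :\ e) (setSD _ (setDS _ sXY)) e.
  rewrite !inE eqxx /= !setD1K ?inE ?eO ?eX ?eY // => /(_ isT).
  lra.
have h0 : nonneg h by move=> S; apply: f0.
have Zh v : \sum_(w | v \in O :\: Z w) mu w <= 1 - q.
  have [vO|vO] := boolP (v \in O); last first.
    rewrite big1 ?subr_ge0 // => w; by rewrite inE (negbTE vO) andbF.
  have := Zq v vO; rewrite -mu1 [X in _ <= X - _](bigID (fun w => v \in Z w)) /=.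
  rewrite [X in _ -> X <= _](eq_bigl (fun w => v \notin Z w)); first lra.
  by move=> w; rewrite inE vO andbT.
have q10 : 0 <= 1 - q by rewrite subr_ge0.
have := random_set_avoids hsub h0 q10 Zh.
rewrite /h setD0 opprB addrCA subrr addr0 => /le_trans; apply.
apply: ler_sum => w _; rewrite setDDr setDv set0U (setIidPr _) //.
Qed.

End Expectation.

(** * Partial minimisation of a submodular function *)

Section Minimisation.
Variables (f : {set V} -> R) (O W : {set V}).
Hypothesis fsub : submodular f.
Hypothesis dOW : [disjoint O & W].

Definition best_in (S : {set V}) : {set V} :=
  [arg min_(Z < (set0 : {set V}) | Z \subset W) f (S :&: O :|: Z)]%O.
Definition fmin (S : {set V}) : R := f (S :&: O :|: best_in S).

Lemma best_in_sub S : best_in S \subset W.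
Proof. by rewrite /best_in; case: arg_minP => //; rewrite sub0set. Qed.

Lemma fmin_le S (Z : {set V}) : Z \subset W -> fmin S <= f (S :&: O :|: Z).
Proof.
rewrite /fmin /best_in; case: arg_minP => [|Z0 _ h]; first by rewrite sub0set.
exact: h.
Qed.

(** The union and the intersection of the two minimisers lie in [W], so they are candidates for
    [A :|: B] and [A :&: B]. Disjointness of [O] and [W] removes the mixed intersections. *)
Lemma fminUI A B : fmin (A :|: B) + fmin (A :&: B) <= fmin A + fmin B.
Proof.
have hU : best_in A :|: best_in B \subset W by rewrite subUset !best_in_sub.
have hI : best_in A :&: best_in B \subset W.
  by apply: subset_trans (subsetIl _ _) (best_in_sub A).
apply: le_trans (submodularUI fsub _ _).
have -> : A :&: O :|: best_in A :|: (B :&: O :|: best_in B) =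
  (A :|: B) :&: O :|: (best_in A :|: best_in B).
  by rewrite setUACA setIUl.
have -> : (A :&: O :|: best_in A) :&: (B :&: O :|: best_in B) =
  (A :&: B) :&: O :|: (best_in A :&: best_in B).
  apply/setP=> x; rewrite !inE.
  have := subsetP (best_in_sub A) x; have := subsetP (best_in_sub B) x.
  have [xO|_] := boolP (x \in O); last by rewrite !andbF.
  rewrite (disjointFr dOW xO) !andbT.
  by case: (x \in best_in A) => [_ /(_ isT)//|]; case: (x \in best_in B) => [/(_ isT)//|];
    rewrite !orbF.
by rewrite lerD ?fmin_le.
Qed.

Lemma fmin_submodular : submodular fmin.
Proof.
move=> X Y sXY e eY; have := fminUI (e |: X) Y.
rewrite -setUA (setUidPr sXY) (_ : (e |: X) :&: Y = X); first by lra.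
apply/setP=> x; rewrite !inE; case: eqP => [->|_] /=.
  by rewrite (negbTE eY); apply/esym/negbTE; apply: contraNN eY; apply: (subsetP sXY).
by case xX: (x \in X) => //=; rewrite (subsetP sXY).
Qed.

End Minimisation.
End Sampling.

(** * The exchange inequality for three coupled greedy runs *)

Section Exchange.
Variables (R : rcfType) (V : finType) (m : nat) (g : V -> 'I_m).
Variables (alpha : nat) (f : {set V} -> R).
Hypothesis fsub : submodular f.
Hypothesis r_gt0 : forall i, (0 < rcap g alpha i)%N.

(* [d a] is the gain of [a] when greedy picked it, and [dl i] is the least such
   gain in group [i], or 0 when greedy left room in group [i]. *)
Definition priced (Rs A : {set V}) (d : V -> R) (dl : 'I_m -> R) : Prop :=
  [/\ A \subset Rs, semi_feasible g alpha A,
      f A = f set0 + \sum_(a in A) d a,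
      forall B, f (B :|: A) - f B <= \sum_(a in A) Num.min (d a) (marg f a B)
    & [/\ forall a, 0 <= d a, forall i, 0 <= dl i,
          forall a, a \in A -> dl (g a) <= d a,
          forall i, (#|A :&: grp g i| < rcap g alpha i)%N -> dl i = 0
        & forall e, e \in Rs :\: A -> marg f e A <= dl (g e)]].

Lemma greedy_out_priced (Rs A : {set V}) :
  greedy_out g alpha f Rs A -> exists d dl, priced Rs A d dl.
Proof.
move=> /(greedy_out_prices fsub)[sAR sfA [d [d0 fA chainA stop]]].
have /fin_all_exists[dl dlP] : forall i : 'I_m, exists x : R,
    [/\ 0 <= x, forall a, a \in A -> g a = i -> x <= d a,
        (#|A :&: grp g i| < rcap g alpha i)%N -> x = 0
      & forall e, e \in Rs :\: A -> g e = i -> marg f e A <= x].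
  move=> i; have [lt|ge] := ltnP #|A :&: grp g i| (rcap g alpha i).
    exists 0; split=> // e eRA gei; have [_] := stop e eRA; rewrite gei; exact.
  (* A full group is nonempty because capacities are positive, so [d] has a minimum over its
     picks. *)
  have /card_gt0P[a0 a0A] : (0 < #|A :&: grp g i|)%N by apply: leq_trans ge.
  exists (d [arg min_(a < a0 in A :&: grp g i) d a]%O).
  case: arg_minP => // a aA le_a; split=> //.
  - by move=> b bA gb; apply: le_a; rewrite !inE bA gb eqxx.
  - move=> e eRA ge'; have [h _] := stop e eRA; apply: h.
      by move: aA; rewrite inE => /andP[].
    by move: aA; rewrite !inE ge' => /andP[_ /eqP].
exists d, dl; split=> //; split=> // [i|a aA|i|e eRA].
- by case: (dlP i).
- by case: (dlP (g a)) => _ h _ _; apply: h.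
- by case: (dlP i).
- by case: (dlP (g e)) => _ _ _ h; apply: h.
Qed.

Lemma sum_by_group (X : {set V}) (F : V -> R) :
  \sum_(v in X) F v = \sum_i \sum_(v in X :&: grp g i) F v.
Proof.
rewrite (partition_big g xpredT) //=; apply: eq_bigr => i _.
by apply: eq_bigl => v; rewrite !inE.
Qed.

Lemma sum_group_const (X : {set V}) (F : 'I_m -> R) :
  \sum_(v in X) F (g v) = \sum_i #|X :&: grp g i|%:R * F i.
Proof.
rewrite sum_by_group; apply: eq_bigr => i _.
rewrite (eq_bigr (fun _ => F i)) ?sumr_const ?mulr_natl //.
by move=> v; rewrite !inE => /andP[_ /eqP->].
Qed.

Variables (O W : {set V}).
Hypothesis dOW : [disjoint O & W].

Section OneSample.
Variables (S A T : {set V}) (d : V -> R) (dl : 'I_m -> R).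
Hypotheses (sSO : S \subset O) (sTS : T \subset S).
Hypothesis pA : priced (W :|: S) A d dl.

Let pE (i : 'I_m) := \sum_(a in (A :\: O) :&: grp g i) d a.
Let nO (i : 'I_m) := #|(A :&: O) :&: grp g i|.

(** A full group has exactly [rcap g alpha i] picks, each of gain at least [dl i]; in a group with
    room, [dl i] is 0. *)
Lemma full_group_price i : (rcap g alpha i)%:R * dl i <= pE i + (nO i)%:R * dl i.
Proof.
have [_ sf _ _ [d0 dl0 dlA dlz _]] := pA.
have [lt|ge] := ltnP #|A :&: grp g i| (rcap g alpha i).
  by rewrite dlz // !mulr0 addr0 sumr_ge0.
have cA : rcap g alpha i = #|A :&: grp g i| by apply/eqP; rewrite eqn_leq sf ge.
have cE : #|A :&: grp g i| = (nO i + #|(A :\: O) :&: grp g i|)%N.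
  by rewrite -(cardsID O (A :&: grp g i)) setIAC /nO setIDAC.
rewrite cA cE natrD mulrDl addrC lerD2r -sumr_const mulr_suml.
apply: ler_sum => a; rewrite !inE mul1r => /andP[/andP[_ aA] /eqP <-]; exact: dlA.
Qed.

Lemma card_exchange i :
  #|(T :\: A) :&: grp g i|%:R + (nO i)%:R =
  #|T :&: grp g i|%:R + #|((A :&: O) :\: T) :&: grp g i|%:R :> R.
Proof.
rewrite -!natrD; congr _%:R.
rewrite -(cardsID A (T :&: grp g i)) /nO -(cardsID T (A :&: O :&: grp g i)).
have -> : A :&: O :&: grp g i :&: T = T :&: grp g i :&: A.
  apply/setP=> x; rewrite !inE; have := subsetP (subset_trans sTS sSO) x.
  by case: (x \in T) => [->//|]; rewrite ?andbF // !andbT andbC.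
rewrite -!setIDAC; lia.
Qed.

(** Items of [T] outside [A] were sampled and rejected, so each gains at most the price of its
    group. Passing from [T :\: B] to [T :\: A] only adds nonnegative prices. *)
Lemma completion_loss (B : {set V}) : A \subset B ->
  f (B :|: T) - f B <= \sum_i #|(T :\: A) :&: grp g i|%:R * dl i.
Proof.
have [_ _ _ _ [_ dl0 _ _ dlS]] := pA.
move=> sAB; apply: le_trans (gain_le_sum_marg fsub T sAB) _.
rewrite -sum_group_const [X in _ <= X](big_setID B) /= setDDl (setUidPr sAB).
apply: ler_wpDl; first by apply: sumr_ge0.
apply: ler_sum => v; rewrite !inE => /andP[vB vT]; apply: dlS.
rewrite !inE (subsetP sTS) // orbT andbT.
by apply: contraNN vB; apply: (subsetP sAB).
Qed.

End OneSample.

Variables (S1 S2 S3 A1 A2 A3 T1 T2 T3 : {set V}).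
Variables (d1 d2 d3 : V -> R) (dl1 dl2 dl3 : 'I_m -> R).
Hypotheses (sS1 : S1 \subset O) (sS2 : S2 \subset O) (sS3 : S3 \subset O).
Hypotheses (sT1 : T1 \subset S1) (sT2 : T2 \subset S2) (sT3 : T3 \subset S3).
Hypotheses (p1 : priced (W :|: S1) A1 d1 dl1) (p2 : priced (W :|: S2) A2 d2 dl2)
           (p3 : priced (W :|: S3) A3 d3 dl3).
Let t (T : {set V}) i := #|T :&: grp g i|.
Hypotheses (t1 : forall i, (t T1 i <= rcap g alpha i)%N)
           (t2 : forall i, (t T2 i <= rcap g alpha i)%N)
           (t3 : forall i, (t T3 i <= rcap g alpha i)%N).
Hypothesis t123 : forall i, (t T1 i + t T2 i + t T3 i <= 2 * rcap g alpha i)%N.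

(** The share of the capacity of group [i] used by [T]. By [t123], the complementary shares of the
    three selections sum to at least 1. *)
Let tau (T : {set V}) i : R := (t T i)%:R / (rcap g alpha i)%:R.

Let rpos i : 0 < (rcap g alpha i)%:R :> R. Proof. by rewrite ltr0n. Qed.

Let tau01 (T : {set V}) i : (t T i <= rcap g alpha i)%N -> 0 <= tau T i <= 1.
Proof.
by move=> h; rewrite /tau divr_ge0 ?ler0n //= ler_pdivrMr // mul1r ler_nat.
Qed.

Let tauM (T : {set V}) i : tau T i * (rcap g alpha i)%:R = (t T i)%:R.
Proof. by rewrite /tau divfK // gt_eqF. Qed.

Let tau2 i : tau T1 i + tau T2 i + tau T3 i <= 2.
Proof.
rewrite /tau -!mulrDl ler_pdivrMr // -!natrD -natrM ler_nat; exact: t123.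
Qed.

(* The picks of the third run outside [O] are also available to the first two
   runs, so their gains are bounded by any of the three prices, in particular by
   any subconvex combination. *)
Lemma third_run_gain :
  f (A1 :|: A2 :|: A3) - f (A1 :|: A2) <=
  \sum_(a in A3 :&: O) d3 a +
  \sum_i ((rcap g alpha i)%:R * ((1 - tau T1 i) * dl1 i + (1 - tau T2 i) * dl2 i) +
          (1 - tau T3 i) * \sum_(a in (A3 :\: O) :&: grp g i) d3 a).
Proof.
have [_ _ _ _ [_ dl01 _ _ dlS1]] := p1.
have [_ _ _ _ [_ dl02 _ _ dlS2]] := p2.
have [sA3 sf3 _ chain3 [d03 _ _ _ _]] := p3.
apply: le_trans (chain3 _) _; rewrite (big_setID O) /=; apply: lerD.
  by apply: ler_sum => a _; rewrite ge_min lexx.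
rewrite sum_by_group; apply: ler_sum => i _.
have /andP[a1 b1] := tau01 (t1 i); have /andP[a2 b2] := tau01 (t2 i).
have /andP[a3 b3] := tau01 (t3 i); have c := tau2 i.
set x := (1 - tau T1 i) * dl1 i + (1 - tau T2 i) * dl2 i.
have x0 : 0 <= x by rewrite addr_ge0 // mulr_ge0 // subr_ge0.
apply: (@le_trans _ _ (\sum_(a in (A3 :\: O) :&: grp g i) (x + (1 - tau T3 i) * d3 a))).
  apply: ler_sum => a; rewrite !inE => /andP[/andP[aO aA] /eqP gai].
  have aW : a \in W by move: (subsetP sA3 a aA); rewrite inE => /orP[//|/(subsetP sS3)]; rewrite (negbTE aO).
  set u := Num.min _ _.
  have d0 := d03 a.
  have u3 : u <= d3 a by rewrite ge_min lexx.
  have um : u <= marg f a (A1 :|: A2) by rewrite ge_min lexx orbT.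
  have e1 := dl01 i; have e2 := dl02 i.
  have y0 : 0 <= (1 - tau T3 i) * d3 a by rewrite mulr_ge0 // subr_ge0.
  have [aB|aB] := boolP (a \in A1 :|: A2).
    by move: um; rewrite marg_in // => um; apply: le_trans um _; rewrite addr_ge0.
  move: (aB); rewrite inE negb_or => /andP[aA1 aA2].
  have u1 : u <= dl1 i.
    rewrite -gai; apply: le_trans um (le_trans (marg_anti fsub (subsetUl _ _) aB) _).
    by apply: dlS1; rewrite !inE aA1 aW.
  have u2 : u <= dl2 i.
    rewrite -gai; apply: le_trans um (le_trans (marg_anti fsub (subsetUr _ _) aB) _).
    by apply: dlS2; rewrite !inE aA2 aW.
  (* The weights [1 - tau] sum to at least 1, so a positive [u] is at most the weighted sum of its
     three bounds; a nonpositive [u] is below that sum because the sum is nonnegative. *)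
  have [un|up] := leP u 0; first by apply: le_trans un _; rewrite addr_ge0.
  have h1 : (1 - tau T1 i) * u <= (1 - tau T1 i) * dl1 i by rewrite ler_wpM2l // subr_ge0.
  have h2 : (1 - tau T2 i) * u <= (1 - tau T2 i) * dl2 i by rewrite ler_wpM2l // subr_ge0.
  have h3 : (1 - tau T3 i) * u <= (1 - tau T3 i) * d3 a by rewrite ler_wpM2l // subr_ge0.
  have h4 : 0 <= (2 - (tau T1 i + tau T2 i + tau T3 i)) * u.
    by rewrite mulr_ge0 ?subr_ge0 // ltW.
  by rewrite /x; lra.
rewrite big_split /= -mulr_sumr lerD2r sumr_const -[x *+ _]mulr_natl ler_wpM2r // ler_nat.
by apply: leq_trans (sf3 i); apply: subset_leq_card; apply: setSI; apply: subsetDl.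
Qed.

(** In each group, runs 1 and 2 pay a share [1 - tau] of [rcap * dl] for the picks of run 3 and a
    share [tau] for their own selection. The total [rcap * dl] is covered by their picks through
    [full_group_price]. Run 3 pays the share [1 - tau] directly from its gains [d3]. *)
Lemma exchange_bound :
  f (A1 :|: A2 :|: A3 :|: T1 :|: T2 :|: T3) <=
  f A1 + \sum_(a in A2) d2 a + \sum_(a in A3 :&: O) d3 a
  + (\sum_(a in A1 :\: O) d1 a + \sum_(a in (A1 :&: O) :\: T1) dl1 (g a))
  + (\sum_(a in A2 :\: O) d2 a + \sum_(a in (A2 :&: O) :\: T2) dl2 (g a))
  + (\sum_(a in A3 :\: O) d3 a + \sum_(a in (A3 :&: O) :\: T3) dl3 (g a)).
Proof.
have [_ _ _ chain2 _] := p2.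
have h2 : f (A1 :|: A2) - f A1 <= \sum_(a in A2) d2 a.
  apply: le_trans (chain2 _) _; by apply: ler_sum => a _; rewrite ge_min lexx.
have h3 := third_run_gain.
set B := A1 :|: A2 :|: A3 in h3 *.
have sA1 : A1 \subset B by rewrite /B -setUA subsetUl.
have sA2 : A2 \subset B by rewrite /B setUAC subsetUr.
have sA3 : A3 \subset B by rewrite /B subsetUr.
have l1 := completion_loss sT1 p1 sA1.
have l2 := completion_loss sT2 p2 (subset_trans sA2 (subsetUl B T1)).
have l3 := completion_loss sT3 p3 (subset_trans sA3 (subset_trans (subsetUl B T1) (subsetUl _ T2))).
rewrite !(sum_by_group (_ :\: O)) !(sum_group_const (_ :\: _)).
suff : \sum_i ((rcap g alpha i)%:R * ((1 - tau T1 i) * dl1 i + (1 - tau T2 i) * dl2 i) +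
          (1 - tau T3 i) * \sum_(a in (A3 :\: O) :&: grp g i) d3 a)
     + \sum_i #|(T1 :\: A1) :&: grp g i|%:R * dl1 i
     + \sum_i #|(T2 :\: A2) :&: grp g i|%:R * dl2 i
     + \sum_i #|(T3 :\: A3) :&: grp g i|%:R * dl3 i
  <= (\sum_i \sum_(a in (A1 :\: O) :&: grp g i) d1 a +
      \sum_i #|((A1 :&: O) :\: T1) :&: grp g i|%:R * dl1 i)
   + (\sum_i \sum_(a in (A2 :\: O) :&: grp g i) d2 a +
      \sum_i #|((A2 :&: O) :\: T2) :&: grp g i|%:R * dl2 i)
   + (\sum_i \sum_(a in (A3 :\: O) :&: grp g i) d3 a +
      \sum_i #|((A3 :&: O) :\: T3) :&: grp g i|%:R * dl3 i).
  by move=> *; lra.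
rewrite -!big_split /=; apply: ler_sum => i _.
have q1 := full_group_price p1 i; have q2 := full_group_price p2 i.
have q3 := full_group_price p3 i.
have c1 := card_exchange A1 sS1 sT1 i; have c2 := card_exchange A2 sS2 sT2 i.
have c3 := card_exchange A3 sS3 sT3 i.
have m1 := tauM T1 i; have m2 := tauM T2 i; have m3 := tauM T3 i.
have /andP[a3 b3] := tau01 (t3 i).
have [_ _ _ _ [_ dl03 _ _ _]] := p3; have dn := dl03 i.
rewrite -/(t T1 i) in c1; rewrite -/(t T2 i) in c2; rewrite -/(t T3 i) in c3.
have n3 : 0 <= #|A3 :&: O :&: grp g i|%:R * dl3 i by rewrite mulr_ge0 // ler0n.
move: (\sum_(a in (A1 :\: O) :&: grp g i) d1 a) (\sum_(a in (A2 :\: O) :&: grp g i) d2 a)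
  (\sum_(a in (A3 :\: O) :&: grp g i) d3 a) q1 q2 q3 => P1 P2 P3 q1 q2 q3.
have -> : #|(T1 :\: A1) :&: grp g i|%:R = tau T1 i * (rcap g alpha i)%:R +
   #|((A1 :&: O) :\: T1) :&: grp g i|%:R - #|A1 :&: O :&: grp g i|%:R by rewrite m1; lra.
have -> : #|(T2 :\: A2) :&: grp g i|%:R = tau T2 i * (rcap g alpha i)%:R +
   #|((A2 :&: O) :\: T2) :&: grp g i|%:R - #|A2 :&: O :&: grp g i|%:R by rewrite m2; lra.
have -> : #|(T3 :\: A3) :&: grp g i|%:R = tau T3 i * (rcap g alpha i)%:R +
   #|((A3 :&: O) :\: T3) :&: grp g i|%:R - #|A3 :&: O :&: grp g i|%:R by rewrite m3; lra.
(* For run 3 only the share [tau T3 i] of [full_group_price] is used; the remaining share of its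
   picks inside [O] has a favourable sign. *)
have k1 : 0 <= tau T3 i * (P3 + #|A3 :&: O :&: grp g i|%:R * dl3 i - (rcap g alpha i)%:R * dl3 i).
  by rewrite mulr_ge0 // subr_ge0.
have k2 : 0 <= (1 - tau T3 i) * (#|A3 :&: O :&: grp g i|%:R * dl3 i).
  by rewrite mulr_ge0 // subr_ge0.
lra.
Qed.

End Exchange.

(** * Bernoulli sampling *)

Section Products.
Variable R : comPzRingType.

(** The fibre of a coordinatewise map over [y] is a product of fibres, so the image of a product law
    is the product of the image laws. *)
Lemma prod_pushforward (I X Y : finType) (w : I -> X -> R) (F : I -> X -> Y)
    (Phi : {ffun I -> Y} -> R) :
  \sum_(x : {ffun I -> X}) \prod_i w i (x i) * Phi [ffun i => F i (x i)] =
  \sum_(y : {ffun I -> Y}) \prod_i (\sum_(z | F i z == y i) w i z) * Phi y.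
Proof.
rewrite (partition_big (fun x : {ffun I -> X} => [ffun i => F i (x i)]) xpredT) //=.
apply: eq_bigr => y _; rewrite bigA_distr_big_dep mulr_suml.
apply: eq_big => [x|x /eqP<- //].
apply/eqP/familyP => [<- i|h]; first by rewrite unfold_in /= ffunE.
by apply/ffunP=> i; rewrite ffunE; have := h i; rewrite unfold_in => /eqP.
Qed.

End Products.

Section Bernoulli.
Variables (R : rcfType) (V : finType) (p : R).

(* Meaningful for [S \subset B] only: the probability that a sample of [B] is [S]. *)
Definition bern (B S : {set V}) : R := p ^+ #|S| * (1 - p) ^+ (#|B| - #|S|).

Lemma bern_prod (B S : {set V}) : S \subset B ->
  bern B S = \prod_(v in B) (if v \in S then p else 1 - p).
Proof.
move=> sSB; rewrite (bigID (mem S)) /= /bern; congr (_ * _).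
  rewrite (eq_bigr (fun _ => p)); last by move=> v /andP[_ ->].
  rewrite (eq_bigl (mem S)) ?prodr_const // => v /=.
  by case vS: (v \in S); rewrite ?andbF // (subsetP sSB).
rewrite (eq_bigr (fun _ => 1 - p)); last by move=> v /andP[_ /negbTE->].
rewrite (eq_bigl (mem (B :\: S))) => [|v /=]; last by rewrite inE andbC.
by rewrite prodr_const cardsD (setIidPr sSB).
Qed.

Lemma bern_total (B : {set V}) : \sum_(S : {set V} | S \subset B) bern B S = 1.
Proof.
(* [F] and [G] weigh presence and absence of [v]. Outside [B] presence has weight 0, so expanding
   the product of [F v + G v] leaves only subsets of [B]. *)
pose F v := if v \in B then p else 0; pose G v := if v \in B then 1 - p else 1.
have : \prod_v (F v + G v) = 1.
  by rewrite big1 // => v _; rewrite /F /G; case: ifP => _; ring.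
rewrite bigA_distr => <-; rewrite [RHS](bigID (fun S : {set V} => S \subset B)) /=.
rewrite [X in _ = _ + X]big1 ?addr0 => [|S /subsetPn[v vS vB]]; last first.
  by rewrite (bigD1 v) //= vS /F (negbTE vB) mul0r.
apply: eq_bigr => S sSB; rewrite bern_prod // [RHS](bigID (mem B)) /=.
rewrite [X in _ = _ * X]big1 ?mulr1 => [|v vB].
  by apply: eq_bigr => v vB; rewrite /F /G vB.
rewrite /G (negbTE vB); case: ifP => // vS; by rewrite (subsetP sSB) in vB.
Qed.

Lemma bern_ge0 (B S : {set V}) : 0 <= p -> p <= 1 -> 0 <= bern B S.
Proof. by move=> p0 p1; rewrite mulr_ge0 // exprn_ge0 // subr_ge0. Qed.

Lemma bern_marginal (B : {set V}) v : v \in B ->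
  \sum_(S : {set V} | (S \subset B) && (v \in S)) bern B S = p.
Proof.
move=> vB; pose F u := if u \in B then p else 0.
pose G u := if u == v then 0 else if u \in B then 1 - p else 1.
have : \prod_u (F u + G u) = p.
  rewrite (bigD1 v) //= big1 ?mulr1 => [|u /negbTE uv].
    by rewrite /F /G vB eqxx addr0.
  by rewrite /F /G uv; case: ifP => _; ring.
rewrite bigA_distr => {1}<-.
rewrite [RHS](bigID (fun S : {set V} => (S \subset B) && (v \in S))) /=.
rewrite [X in _ = _ + X]big1 ?addr0 => [|S]; last first.
  rewrite negb_and => /orP[/subsetPn[u uS uB]|vS].
    by rewrite (bigD1 u) //= uS /F (negbTE uB) mul0r.
  by rewrite (bigD1 v) //= (negbTE vS) /G eqxx mul0r.
apply: eq_bigr => S /andP[sSB vS]; rewrite bern_prod // [RHS](bigID (mem B)) /=.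
rewrite [X in _ = _ * X]big1 ?mulr1 => [|u uB].
  apply: eq_bigr => u uB; rewrite /F /G uB; case: ifP => // uS.
  by case: eqP uS => // ->; rewrite vS.
rewrite /G (negbTE uB); case: ifP => [uS|_]; first by rewrite (subsetP sSB) in uB.
by case: eqP uB => // ->; rewrite vB.
Qed.

Lemma expect_sample_split (O : {set V}) (h : {set V} -> R) :
  expect_sample p h =
  \sum_(W : {set V} | W \subset ~: O) bern (~: O) W *
    \sum_(S : {set V} | S \subset O) bern O S * h (W :|: S).
Proof.
under [RHS]eq_bigr do rewrite mulr_sumr.
rewrite pair_big_dep /= /expect_sample.
rewrite [RHS](reindex_onto (fun Rs : {set V} => (Rs :\: O, Rs :&: O)) (fun q => q.1 :|: q.2)) /=.
  apply: eq_big => [Rs|Rs _].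
    by rewrite subsetIr setUC setID eqxx -setTD setSD // subsetT.
  rewrite setUC setID mulrA; congr (_ * _).
  have -> : p ^+ #|Rs| * (1 - p) ^+ (#|V| - #|Rs|) = bern setT Rs by rewrite /bern cardsT.
  rewrite !bern_prod ?subsetT ?subsetIr -?setTD ?setSD ?subsetT //.
  rewrite (bigID (mem O)) /= mulrC; congr (_ * _); apply: eq_big => v; rewrite !inE ?andbT //=.
    by move=> /negbTE->.
  by move=> ->; rewrite andbT.
case=> W S /= /andP[sW sS]; congr (_, _); apply/setP=> v; rewrite !inE.
  have := subsetP sW v; have := subsetP sS v; rewrite inE.
  by case: (v \in O); case: (v \in W); case: (v \in S) => //= a b;
    first [by have := a isT | by have := b isT].
have := subsetP sW v; have := subsetP sS v; rewrite inE.
by case: (v \in O); case: (v \in W); case: (v \in S) => //= a b;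
    first [by have := a isT | by have := b isT].
Qed.

(** The blocks partition [O], so families of subsets of the blocks correspond to subsets of [O], and
    the block probabilities multiply to [bern O S]. *)
Lemma bern_family (I : finType) (sl : V -> I) (O : {set V}) (Phi : {set V} -> R) :
  \sum_(y : {ffun I -> {set V}})
     \prod_s (if y s \subset [set v in O | sl v == s]
              then bern [set v in O | sl v == s] (y s) else 0) * Phi (\bigcup_s y s) =
  \sum_(S : {set V} | S \subset O) bern O S * Phi S.
Proof.
pose blk s := [set v in O | sl v == s].
rewrite (bigID (fun y : {ffun I -> {set V}} => [forall s, y s \subset blk s])) /=.
rewrite [X in _ + X]big1 ?addr0 => [|y]; last first.
  rewrite negb_forall => /existsP[s /negbTE ns].
  by rewrite (bigD1 s) //= -/(blk s) ns !mul0r.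
have cap (S : {set V}) s v : (v \in S :&: blk s) = [&& v \in S, v \in O & sl v == s].
  by rewrite !inE.
rewrite (reindex_onto (fun S : {set V} => [ffun s => S :&: blk s])
                      (fun y : {ffun I -> {set V}} => \bigcup_s y s)) /=; last first.
  move=> y /forallP ys; apply/ffunP=> s; rewrite ffunE; apply/setP=> v; rewrite cap.
  apply/and3P/idP => [[/bigcupP[s' _ vs'] vO /eqP sv]|vys].
    by have := subsetP (ys s') v vs'; rewrite inE sv => /andP[_ /eqP->].
  have := subsetP (ys s) v vys; rewrite inE => /andP[vO sv]; split=> //.
  by apply/bigcupP; exists s.
have cupE (S : {set V}) : \bigcup_s [ffun s => S :&: blk s] s = S :&: O.
  apply/setP=> v; rewrite inE; apply/bigcupP/andP => [[s _]|[vS vO]].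
    by rewrite ffunE cap => /and3P[-> ->].
  by exists (sl v) => //; rewrite ffunE cap vS vO eqxx.
apply: eq_big => [S|S].
  rewrite cupE; have -> : [forall s, [ffun s => S :&: blk s] s \subset blk s].
    by apply/forallP=> s; rewrite ffunE subsetIr.
  by rewrite andTb; apply/eqP/setIidPl.
rewrite cupE => /andP[_ /eqP/setIidPl sSO]; rewrite (setIidPl sSO) bern_prod //; congr (_ * _).
rewrite (partition_big sl xpredT) //=; apply: eq_bigr => s _.
rewrite ffunE subsetIr bern_prod ?subsetIr //.
apply: eq_big => [v|v]; first by rewrite inE.
by rewrite inE => /andP[vO sv]; rewrite !inE vO sv !andbT.
Qed.

(** * A uniform element of a Bernoulli sample *)

Section UniformPick.
Variable B : {set V}.

(** The transposition of [u] and [v] preserves [B] and all cardinalities. *)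
Lemma bern_pick_sym (u v : V) : u \in B -> v \in B ->
  \sum_(S : {set V} | (S \subset B) && (u \in S)) bern B S / #|S|%:R =
  \sum_(S : {set V} | (S \subset B) && (v \in S)) bern B S / #|S|%:R.
Proof.
move=> uB vB; pose h (S : {set V}) := [set tperm u v x | x in S].
have hinj : injective h by apply: imset_inj; apply: perm_inj.
have hB (S : {set V}) : S \subset B -> h S \subset B.
  move=> sSB; apply/subsetP=> _ /imsetP[x xS ->].
  by case: tpermP => // _ _; apply: (subsetP sSB).
have hK (S : {set V}) : h (h S) = S.
  by rewrite /h -imset_comp (eq_imset (g := id)) ?imset_id // => x /=; rewrite tpermK.
rewrite [RHS](reindex_inj hinj) /=; apply: eq_big => [S|S _].
  congr (_ && _); first by apply/idP/idP => [/hB//|/hB]; rewrite hK.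
  by rewrite -{1}(tpermL u v) mem_imset //; apply: perm_inj.
by rewrite /bern !card_imset //; apply: perm_inj.
Qed.

(** By symmetry all items of [B] are equally likely to be the uniform element, and these
    probabilities sum to that of a nonempty sample. *)
Lemma bern_pick (v : V) : v \in B ->
  #|B|%:R * (\sum_(S : {set V} | (S \subset B) && (v \in S)) bern B S / #|S|%:R) =
  1 - (1 - p) ^+ #|B|.
Proof.
move=> vB; rewrite mulr_natl -sumr_const.
rewrite (eq_bigr (fun u => \sum_(S : {set V} | (S \subset B) && (u \in S)) bern B S / #|S|%:R));
  last by move=> u uB; apply: bern_pick_sym.
rewrite (exchange_big_dep (fun S : {set V} => S \subset B)) /=; last by move=> u S _ /andP[].
have tot := bern_total B; rewrite (bigD1 set0) ?sub0set //= in tot.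
rewrite (bigD1 set0) ?sub0set //= big_pred0 => [|u]; last by rewrite inE !andbF.
have e0 : bern B set0 = (1 - p) ^+ #|B| by rewrite /bern cards0 expr0 mul1r subn0.
have rest : \sum_(S : {set V} | (S \subset B) && (S != set0)) bern B S = 1 - (1 - p) ^+ #|B|.
  by rewrite -e0; lra.
rewrite add0r -rest.
apply: eq_bigr => S /andP[sSB S0].
rewrite (eq_bigl (mem S)); last first.
  by move=> u; rewrite /= sSB; case uS: (u \in S); rewrite ?andbF // (subsetP sSB).
by rewrite sumr_const -[(_ / _) *+ _]mulr_natr divfK // pnatr_eq0 cards_eq0.
Qed.

End UniformPick.
End Bernoulli.

(** * Coupling three samples of a slot *)

Section Slot.
Variables (R : rcfType) (V : finType) (p : R).
(** A rational interval around the sampling probability 0.30901... *)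
Hypotheses (p_lo : 309%:R / 1000%:R <= p) (p_hi : p <= 31%:R / 100%:R).
Let p0 : 0 <= p. Proof. by apply: le_trans p_lo; lra. Qed.
Let p1 : p <= 1. Proof. by apply: le_trans p_hi _; lra. Qed.

Variables (B : {set V}) (ps : V -> 'I_3).
Hypothesis ps_inj : {in B &, injective ps}.

(* A slot is a set [B] of at most three items, with distinct positions [ps]. For
   a uniform [s], sample number [s.1] selects nothing and the other two select the
   items, if any, at two distinct positions; each item of [B] is thus selected by
   each of the three samples with probability 2/9. *)
Definition selected (k : 'I_3) (s : 'I_3 * 'I_3) : {set V} :=
  [set v in B | (k != s.1) && (ps v == s.2 + (k - s.1))].

Let n := #|B|.
Let hit : R := 1 - (1 - p) ^+ n.
Let theta : R := 2%:R / 9%:R * n%:R / hit.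

(* The law of a sample [S] of [B] conditioned on its selection [T]: [S] is
   Bernoulli, and [T] is a uniform element of [S] with probability [theta], and
   empty otherwise. The value of [theta] makes every selection probability 2/9. *)
Definition kernel (T S : {set V}) : R :=
  if ~~ (S \subset B) then 0
  else if T == set0 then
    bern p B S * (if S == set0 then 1 else 1 - theta) / (1 - 2%:R / 9%:R * n%:R)
  else if T \subset S then 9%:R / 2%:R * theta * (bern p B S / #|S|%:R) else 0.

Definition slot_sample : Type := ('I_3 * 'I_3 * {ffun 'I_3 -> {set V}})%type.
HB.instance Definition _ := Finite.on slot_sample.

(** A uniform [s], then three samples that are independent given [s]. *)
Definition slot_weight (x : slot_sample) : R :=
  9%:R^-1 * \prod_k kernel (selected k x.1) (x.2 k).

Lemma slot_card_le3 : (n <= 3)%N.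
Proof.
by rewrite /n -(card_in_imset ps_inj) -[X in (_ <= X)%N](card_ord 3) max_card.
Qed.


(** The first inequality makes [theta] at most 1, the second yields the 33/100 of [theta_share].
    Both are tightest for three items, where [hit] is about 0.67. *)
Lemma hit_bounds : 2%:R / 9%:R * n%:R <= hit /\ hit * (33%:R / 100%:R) <= 2%:R / 9%:R.
Proof.
have := slot_card_le3; have := p_lo; have := p_hi; rewrite /hit.
case: n => [|[|[|[|//]]]] hi lo _; rewrite ?expr0 ?expr1.
- by split; lra.
- by split; lra.
- by split; nra.
have q1 : 69%:R/100%:R <= 1 - p by lra.
have q2 : 1 - p <= 691%:R/1000%:R by lra.
move: (1 - p) q1 q2 => q q1 q2.
have r1 : 476%:R/1000%:R <= q ^+ 2 by rewrite expr2; nra.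
have r2 : q ^+ 2 <= 478%:R/1000%:R by rewrite expr2; nra.
rewrite exprSr; move: (q ^+ 2) r1 r2 => r r1 r2.
by split; nra.
Qed.

Lemma hit_gt0 : (0 < n)%N -> 0 < hit.
Proof.
have [h _] := hit_bounds => n0; apply: lt_le_trans h.
by rewrite mulr_gt0 // ?ltr0n //; lra.
Qed.

Lemma theta_hit : theta * hit = 2%:R / 9%:R * n%:R.
Proof.
rewrite /theta; case: (posnP n) => [->|n0]; first by rewrite !mulr0 !mul0r.
by rewrite divfK // gt_eqF // hit_gt0.
Qed.

Lemma theta_bounds : 0 <= theta <= 1.
Proof.
case: (posnP n) => [n0|n0]; first by rewrite /theta n0 mulr0 mul0r lexx ler01.
have h := hit_gt0 n0; have [h1 _] := hit_bounds.
rewrite /theta ler_pdivrMr // mul1r h1 andbT.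
by rewrite divr_ge0 ?mulr_ge0 ?ler0n ?invr_ge0 ?ler0n // ltW.
Qed.

(** This ratio is the probability that a given element of the sample [S] is its selection. It is
    least when [S] is all of [B], where it equals 2/9 divided by [hit]. *)
Lemma theta_share (S : {set V}) : S \subset B -> S != set0 ->
  33%:R / 100%:R <= theta / #|S|%:R.
Proof.
move=> sSB S0; have c0 : (0 < #|S|)%N by rewrite card_gt0.
have cn : (#|S| <= n)%N by apply: subset_leq_card.
have n0 : (0 < n)%N by apply: leq_trans cn.
have h := hit_gt0 n0; have [_ h2] := hit_bounds.
rewrite ler_pdivlMr ?ltr0n // /theta ler_pdivlMr //.
have : #|S|%:R <= n%:R :> R by rewrite ler_nat.
have : 0 <= #|S|%:R :> R by rewrite ler0n.
nra.
Qed.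

Let empty_gt0 : 0 < 1 - 2%:R / 9%:R * n%:R :> R.
Proof.
have : n%:R <= 3%:R :> R by rewrite ler_nat slot_card_le3.
lra.
Qed.

Lemma kernel_ge0 T S : 0 <= kernel T S.
Proof.
have /andP[t0 t1] := theta_bounds; have b0 := bern_ge0 B S p0 p1.
rewrite /kernel; case: ifP => // _; case: ifP => _.
  apply: divr_ge0; last exact: ltW.
  by rewrite mulr_ge0 //; case: ifP => // _; rewrite subr_ge0.
case: ifP => // _; rewrite mulr_ge0 ?divr_ge0 ?ler0n //.
by rewrite mulr_ge0 // divr_ge0 ?ler0n.
Qed.

Lemma selected_cases k s : selected k s = set0 \/ exists2 v, v \in B & selected k s = [set v].
Proof.
have [->|[v vT]] := set_0Vmem (selected k s); first by left.
right; exists v; first by move: vT; rewrite inE => /andP[].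
apply/setP=> u; move: vT; rewrite !inE => /and3P[vB -> /eqP vs].
apply/and3P/eqP => [[uB _ /eqP us]|->]; last by rewrite vs.
by apply: ps_inj => //; rewrite us vs.
Qed.

(** The normalising factors of [kernel] are the inverse probabilities of the selections: 2/9 for
    each singleton by [bern_pick] and the choice of [theta], and the remaining mass for the empty
    selection. *)
Lemma kernel_total k s : \sum_S kernel (selected k s) S = 1.
Proof.
rewrite (bigID (fun S : {set V} => S \subset B)) /= [X in _ + X]big1 ?addr0; last first.
  by move=> S nS; rewrite /kernel nS.
have [->|[v vB ->]] := selected_cases k s.
  rewrite (eq_bigr (fun S => (bern p B S - theta * (if S == set0 then 0 else bern p B S))
                     / (1 - 2%:R / 9%:R * n%:R))); last first.
    by move=> S sSB; rewrite /kernel sSB eqxx /=; case: ifP => _; congr (_ / _); ring.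
  rewrite -mulr_suml sumrB -mulr_sumr.
  have tot := bern_total p B.
  have e0 : bern p B set0 = (1 - p) ^+ n by rewrite /bern cards0 expr0 mul1r subn0.
  have -> : \sum_(S : {set V} | S \subset B) (if S == set0 then 0 else bern p B S) = hit.
    rewrite (bigD1 set0) ?sub0set //= eqxx add0r (eq_bigr (bern p B)) => [|S /andP[_ /negbTE->]//].
    by move: tot; rewrite (bigD1 set0) ?sub0set //= /hit -e0; lra.
  by rewrite tot theta_hit divff // gt_eqF.
rewrite (eq_bigr (fun S : {set V} => if v \in S then 9%:R / 2%:R * theta * (bern p B S / #|S|%:R) else 0));
  last first.
  move=> S sSB; rewrite /kernel sSB /= sub1set; case: eqP => // /setP/(_ v).
  by rewrite !inE eqxx.
rewrite -big_mkcondr -mulr_sumr; have n0 : (0 < n)%N by apply/card_gt0P; exists v.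
have nN0 : n%:R != 0 :> R by rewrite pnatr_eq0 -lt0n.
have h0 : hit != 0 by rewrite gt_eqF // hit_gt0.
have := bern_pick p vB; rewrite -/n -/hit => h.
apply: (mulfI nN0); rewrite mulrCA h.
transitivity (9%:R / 2%:R * (theta * hit)); first by rewrite !mulrA.
by rewrite theta_hit; field.
Qed.

(** The three [s] with [s.1 = k] select nothing. For each of the two other values of [s.1], the
    shifted position runs once through ['I_3], so every item is selected exactly twice among the
    nine [s]. *)
Lemma sum_selected k (G : {set V} -> R) :
  \sum_s G (selected k s) = (9%:R - 2%:R * n%:R) * G set0 + 2%:R * \sum_(v in B) G [set v].
Proof.
pose atpos j := [set v in B | ps v == j].
have pos : \sum_j G (atpos j) = (3%:R - n%:R) * G set0 + \sum_(v in B) G [set v].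
  rewrite (bigID (fun j => j \in ps @: B)) /= addrC; congr (_ + _).
    rewrite (eq_bigr (fun _ => G set0)) => [|j nj]; last first.
      congr G; apply/setP=> v; rewrite !inE; apply/negP => /andP[vB /eqP vj].
      by move/negP: nj; apply; rewrite -vj; apply: imset_f.
    rewrite (eq_bigl (mem (~: (ps @: B)))) => [|j /=]; last by rewrite inE.
    rewrite sumr_const -[G set0 *+ _]mulr_natl; congr (_ * _).
    have := cardsC (ps @: B); rewrite (card_in_imset ps_inj) card_ord -/n => h.
    have -> : 3%:R = n%:R + #|~: (ps @: B)|%:R :> R by rewrite -natrD h.
    by rewrite addrC addKr.
  rewrite big_imset //; apply: eq_bigr => v vB; congr G; apply/setP=> u.
  rewrite !inE; apply/andP/eqP => [[uB /eqP]|->]; last by rewrite eqxx.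
  exact: ps_inj.
have -> : \sum_s G (selected k s) = \sum_k0 \sum_c G (selected k (k0, c)) by rewrite pair_bigA.
rewrite (bigD1 k) //= (eq_bigr (fun _ => G set0)) => [|c _]; last first.
  by congr G; apply/setP=> v; rewrite !inE /= eqxx andbF.
rewrite sumr_const card_ord (eq_bigr (fun _ => \sum_j G (atpos j))) => [|k0 k0k]; last first.
  rewrite [RHS](reindex_inj (addIr (k - k0))) /=; apply: eq_bigr => c _.
  by congr G; apply/setP=> v; rewrite !inE /= eq_sym k0k.
rewrite (eq_bigl (mem [set~ k])) => [|j /=]; last by rewrite !inE.
rewrite sumr_const cardsC1 card_ord /= pos; ring.
Qed.

Lemma slot_weight_ge0 x : 0 <= slot_weight x.
Proof. by rewrite mulr_ge0 ?invr_ge0 ?ler0n // prodr_ge0 // => k _; apply: kernel_ge0. Qed.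

Lemma slot_marginal k (y : {set V}) (F : 'I_3 * 'I_3 -> R) :
  \sum_(x : slot_sample | x.2 k == y) slot_weight x * F x.1 =
  9%:R^-1 * \sum_s kernel (selected k s) y * F s.
Proof.
have -> : \sum_(x : slot_sample | x.2 k == y) slot_weight x * F x.1 =
  \sum_s \sum_(S : {ffun 'I_3 -> {set V}} | S k == y) slot_weight (s, S) * F s.
  by rewrite pair_big_dep; apply: eq_big => [[s S]|[s S] _].
rewrite mulr_sumr; apply: eq_bigr => s _; rewrite /slot_weight /=.
rewrite -mulr_suml -mulr_sumr -mulrA; congr (_ * (_ * _)).
rewrite (eq_bigl (fun S => S \in family (fun l => [pred z | (l == k) ==> (z == y)]))); last first.
  move=> S; apply/eqP/familyP => [h l|/(_ k)]; last by rewrite /= eqxx => /eqP.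
  by rewrite /=; apply/implyP => /eqP->; rewrite h.
rewrite -(bigA_distr_big_dep _ (fun l z => kernel (selected l s) z)) (bigD1 k) //=.
rewrite [X in _ * X]big1 ?mulr1 => [|l lk].
  by rewrite (eq_bigl (pred1 y)) ?big_pred1_eq // => z /=; rewrite eqxx.
by rewrite -(kernel_total l s); apply: eq_bigl => z /=; rewrite (negbTE lk).
Qed.

(** Averaging [kernel] over the selections undoes the conditioning: for nonempty [y], the empty
    selection contributes a share [1 - theta] and the elements of [y] together a share [theta]. *)
Lemma slot_law k (y : {set V}) :
  \sum_(x : slot_sample | x.2 k == y) slot_weight x = if y \subset B then bern p B y else 0.
Proof.
rewrite (eq_bigr (fun x => slot_weight x * 1)); last by move=> x _; rewrite mulr1.
rewrite (slot_marginal k y (fun _ => 1)).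
under eq_bigr do rewrite mulr1.
rewrite (sum_selected k (fun T => kernel T y)); case: ifP => syB; last first.
  rewrite /kernel syB /= big1 //; by rewrite !mulr0 addr0 mulr0.
have K0 : 9%:R^-1 * ((9%:R - 2%:R * n%:R) * kernel set0 y) =
  bern p B y * (if y == set0 then 1 else 1 - theta).
  rewrite /kernel syB eqxx /=; move: empty_gt0 => /gt_eqF/negbT e0.
  rewrite (_ : 9%:R - 2%:R * n%:R = 9%:R * (1 - 2%:R / 9%:R * n%:R)); last by field.
  move: (1 - _) e0 => e e0; by field.
have K1 : 9%:R^-1 * (2%:R * \sum_(v in B) kernel [set v] y) =
  bern p B y * (if y == set0 then 0 else theta).
  rewrite (eq_bigr (fun v => if v \in y then 9%:R / 2%:R * theta * (bern p B y / #|y|%:R) else 0));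
    last first.
    move=> v vB; rewrite /kernel syB /= sub1set; case: eqP => // /setP/(_ v).
    by rewrite !inE eqxx.
  rewrite -big_mkcondr (eq_bigl (mem y)) => [|v /=]; last first.
    by case vy: (v \in y); rewrite ?andbF // (subsetP syB).
  rewrite sumr_const -[_ *+ #|y|]mulr_natl; case: eqP => [->|/eqP y0].
    by rewrite cards0 !(mul0r, mulr0).
  have c0 : #|y|%:R != 0 :> R by rewrite pnatr_eq0 cards_eq0.
  by move: (#|y|%:R) c0 => c c0; field.
by rewrite mulrDr K0 K1 -mulrDr; case: ifP => _; ring.
Qed.

Lemma slot_select k (y : {set V}) v : y \subset B -> v \in y ->
  33%:R / 100%:R * bern p B y <=
  \sum_(x : slot_sample | x.2 k == y) slot_weight x * (v \in selected k x.1)%:R.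
Proof.
move=> syB vy; have vB := subsetP syB v vy.
rewrite (slot_marginal k y (fun s => (v \in selected k s)%:R)).
rewrite (sum_selected k (fun T => kernel T y * (v \in T)%:R)) inE mulr0 mulr0 add0r.
rewrite (bigD1 v) //= big1 => [|u /andP[_ uv]]; last by rewrite inE eq_sym (negbTE uv) mulr0.
rewrite inE eqxx mulr1 addr0 /kernel syB /= sub1set vy.
case: eqP => [/setP/(_ v)|_]; first by rewrite !inE eqxx.
have y0 : y != set0 by apply/set0Pn; exists v.
have := theta_share syB y0; have := bern_ge0 B y p0 p1.
move: (bern p B y) => b b0 h.
have -> : 9%:R^-1 * (2%:R * (9%:R / 2%:R * theta * (b / #|y|%:R))) = theta / #|y|%:R * b.
  have c0 : #|y|%:R != 0 :> R by rewrite pnatr_eq0 cards_eq0.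
  by move: (#|y|%:R) c0 => c c0; field.
by rewrite ler_wpM2r.
Qed.

Lemma slot_cover k v : v \in B ->
  \sum_(x : slot_sample) slot_weight x * (v \in selected k x.1)%:R = 2%:R / 9%:R.
Proof.
move=> vB; rewrite (partition_big (fun x : slot_sample => x.2 k) xpredT) //=.
under eq_bigr do rewrite (slot_marginal k _ (fun s => (v \in selected k s)%:R)).
rewrite -mulr_sumr exchange_big /=.
under eq_bigr do rewrite -mulr_suml kernel_total mul1r.
rewrite (sum_selected k (fun T => (v \in T)%:R)) inE mulr0 add0r.
rewrite (bigD1 v) //= big1 => [|u /andP[_ uv]]; last by rewrite inE eq_sym (negbTE uv).
by rewrite inE eqxx addr0 mulr1 mulrC.
Qed.

Lemma slot_selected_sub k x : slot_weight x != 0 -> selected k x.1 \subset x.2 k.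
Proof.
apply: contraR => nsub; rewrite /slot_weight (bigD1 k) //= {1}/kernel.
case: ifP => _; first by rewrite mul0r mulr0.
have [T0|_] := eqVneq (selected k x.1) set0; first by rewrite T0 sub0set in nsub.
rewrite (negbTE nsub).
by rewrite mul0r mulr0.
Qed.

End Slot.

(** * Coupling three samples *)

Section Coupling.
Variables (R : rcfType) (V I : finType) (p : R).
Hypotheses (p_lo : 309%:R / 1000%:R <= p) (p_hi : p <= 31%:R / 100%:R).
Variables (O : {set V}) (sl : V -> I) (ps : V -> 'I_3).
Hypothesis sl_ps_inj : {in O &, forall u v, sl u = sl v -> ps u = ps v -> u = v}.

Definition slot (s : I) : {set V} := [set v in O | sl v == s].

Definition coupling : finType := {ffun I -> slot_sample V}.

Definition weight (x : coupling) : R := \prod_s slot_weight p (slot s) ps (x s).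

Definition sample (k : 'I_3) (x : coupling) : {set V} := \bigcup_s (x s).2 k.

Definition picked (k : 'I_3) (x : coupling) : {set V} :=
  [set v in O | v \in selected (slot (sl v)) ps k (x (sl v)).1].

Let ps_inj s : {in slot s &, injective ps}.
Proof.
move=> u v; rewrite !inE => /andP[uO /eqP us] /andP[vO /eqP vs].
by apply: sl_ps_inj => //; rewrite us vs.
Qed.

Lemma weight_ge0 x : 0 <= weight x.
Proof. by apply: prodr_ge0 => s _; apply: slot_weight_ge0. Qed.

Lemma slot_weight_total s : \sum_(z : slot_sample V) slot_weight p (slot s) ps z = 1.
Proof.
rewrite (partition_big (fun z : slot_sample V => z.2 ord0) xpredT) //=.
under eq_bigr do rewrite (slot_law p_lo p_hi (@ps_inj s)).
by rewrite -big_mkcond bern_total.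
Qed.

Lemma weight_neq0 x s : weight x != 0 -> slot_weight p (slot s) ps (x s) != 0.
Proof. by rewrite /weight (bigD1 s) //=; apply: contraNneq => ->; rewrite mul0r. Qed.

Lemma sample_law k (Phi : {set V} -> R) :
  \sum_x weight x * Phi (sample k x) = \sum_(S : {set V} | S \subset O) bern p O S * Phi S.
Proof.
rewrite -(bern_family p sl O).
pose F (s : I) (z : slot_sample V) := z.2 k.
pose Psi (y : {ffun I -> {set V}}) := Phi (\bigcup_s y s).
rewrite (eq_bigr (fun x : coupling => \prod_s slot_weight p (slot s) ps (x s) *
   Psi [ffun s => F s (x s)])) => [|x _]; last first.
  by congr (_ * Phi _); apply: eq_bigr => s _; rewrite ffunE.
rewrite (prod_pushforward (fun s z => slot_weight p (slot s) ps z)).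
apply: eq_bigr => y _; congr (_ * _); apply: eq_bigr => s _.
exact: (slot_law p_lo p_hi (@ps_inj s)).
Qed.

Lemma weight_total : \sum_x weight x = 1.
Proof.
have := sample_law ord0 (fun _ => 1).
by under eq_bigr do rewrite mulr1; under [RHS]eq_bigr do rewrite mulr1; rewrite bern_total.
Qed.

Lemma picked_weight k v x : v \in O ->
  weight x * (v \in picked k x)%:R =
  \prod_s (slot_weight p (slot s) ps (x s) *
           (if s == sl v then (v \in selected (slot s) ps k (x s).1)%:R else 1)).
Proof.
move=> vO; rewrite big_split /=; congr (_ * _).
rewrite (bigD1 (sl v)) //= eqxx big1 => [|s /negbTE sv]; last by rewrite sv.
by rewrite mulr1 inE vO.
Qed.

Lemma picked_cover k v : v \in O -> \sum_x weight x * (v \in picked k x)%:R = 2%:R / 9%:R.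
Proof.
move=> vO; under eq_bigr do rewrite picked_weight //.
rewrite -(bigA_distr_bigA (fun s (z : slot_sample V) => slot_weight p (slot s) ps z *
           (if s == sl v then (v \in selected (slot s) ps k z.1)%:R else 1))) /=.
rewrite (bigD1 (sl v)) //= [X in _ * X]big1 ?mulr1 => [|s /negbTE sv].
  under eq_bigr do rewrite eqxx.
  by apply: (slot_cover p_lo p_hi (@ps_inj (sl v))); rewrite inE vO eqxx.
by under eq_bigr do rewrite sv mulr1; apply: slot_weight_total.
Qed.

(** [psi] depends on sample [k] only. Once that sample is fixed in every slot, the selection of [v]
    concerns its own slot alone, where [slot_select] gives the factor 33/100; the other slots
    contribute their exact law. *)
Lemma picked_share k v (psi : {set V} -> R) : v \in O -> (forall S, 0 <= psi S) ->
  33%:R / 100%:R *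
    \sum_(S : {set V} | S \subset O) bern p O S * (psi S * (v \in S)%:R) <=
  \sum_x weight x * (psi (sample k x) * (v \in picked k x)%:R).
Proof.
move=> vO psi0; rewrite mulr_sumr.
under eq_bigr do rewrite mulrCA.
rewrite -(bern_family p sl O (fun S => 33%:R / 100%:R * (psi S * (v \in S)%:R))).
pose w s (z : slot_sample V) := slot_weight p (slot s) ps z *
           (if s == sl v then (v \in selected (slot s) ps k z.1)%:R else 1).
pose F (s : I) (z : slot_sample V) := z.2 k.
pose Psi (y : {ffun I -> {set V}}) := psi (\bigcup_s y s).
have w0 s z : 0 <= w s z.
  by rewrite mulr_ge0 ?slot_weight_ge0 //; case: ifP => // _; rewrite ler0n.
rewrite [X in _ <= X](eq_bigr (fun x : coupling => \prod_s w s (x s) *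
   Psi [ffun s => F s (x s)])) => [|x _]; last first.
  rewrite mulrCA picked_weight // mulrC; congr (_ * psi _).
  by apply: eq_bigr => s _; rewrite ffunE.
rewrite (prod_pushforward w); apply: ler_sum => y _.
have rhs0 : 0 <= \prod_i (\sum_(z | F i z == y i) w i z) * Psi y.
  by rewrite mulr_ge0 ?psi0 // prodr_ge0 // => i _; rewrite sumr_ge0.
have [vy|_] := boolP (v \in \bigcup_s y s); last by rewrite !mulr0.
have [/forallP ys|/forallPn[s /negbTE ys]] := boolP [forall s, y s \subset slot s]; last first.
  by rewrite (bigD1 s) //= -/(slot s) ys !mul0r.
have {}vy : v \in y (sl v).
  case/bigcupP: vy => s _ vys; move: (subsetP (ys s) v vys).
  by rewrite inE => /andP[_ /eqP->].
rewrite mulr1 mulrA ler_wpM2r ?psi0 // mulrC.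
rewrite (bigD1 (sl v)) //= [X in _ <= X](bigD1 (sl v)) //= -/(slot _) ys mulrA.
have E s : s != sl v -> \sum_(z | F s z == y s) w s z =
    if y s \subset [set v0 in O | sl v0 == s] then bern p [set v0 in O | sl v0 == s] (y s) else 0.
  move=> /negbTE sv; rewrite /w sv; under eq_bigr do rewrite mulr1.
  exact: (slot_law p_lo p_hi (@ps_inj s)).
rewrite [X in _ <= _ * X](eq_bigr _ E) ler_wpM2r //.
  apply: prodr_ge0 => s _; case: ifP => // _; apply: bern_ge0.
    by apply: le_trans p_lo; lra.
  by apply: le_trans p_hi _; lra.
rewrite /w eqxx; exact: (slot_select p_lo p_hi (@ps_inj (sl v)) k (ys _) vy).
Qed.

Lemma sample_sub k x : weight x != 0 -> sample k x \subset O.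
Proof.
move=> wx; apply/bigcupsP => s _; have := weight_neq0 s wx.
apply: contraR => nsub; rewrite /slot_weight (bigD1 k) //= {1}/kernel.
rewrite (_ : _ \subset slot s = false) ?mul0r ?mulr0 //.
by apply/negP => h; move/negP: nsub; apply; apply: subset_trans h _; apply/subsetP => v;
  rewrite inE => /andP[].
Qed.

Lemma picked_sub k x : weight x != 0 -> picked k x \subset sample k x.
Proof.
move=> wx; apply/subsetP => v; rewrite inE => /andP[vO vs].
apply/bigcupP; exists (sl v) => //.
exact: (subsetP (slot_selected_sub k (weight_neq0 (sl v) wx))).
Qed.

Lemma picked_subO k x : picked k x \subset O.
Proof. by apply/subsetP => v; rewrite inE => /andP[]. Qed.

Lemma picked_disjoint k l x v : v \in picked k x -> v \in picked l x -> k = l.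
Proof.
rewrite !inE => /and3P[_ _ /andP[_ /eqP->]] /and3P[_ _ /andP[_ /eqP]].
by move=> /addrI/addIr.
Qed.

Lemma picked_group_card k x (G : {set V}) :
  (#|picked k x :&: G| <= #|[set s in sl @: (O :&: G) | k != (x s).1.1]|)%N.
Proof.
have inj : {in picked k x :&: G &, injective sl}.
  move=> u v; rewrite !inE => /andP[/and3P[uO _ /andP[_ /eqP pu]] _].
  move=> /andP[/and3P[vO _ /andP[_ /eqP pv]] _] uv.
  by apply: sl_ps_inj => //; rewrite pu pv uv.
rewrite -(card_in_imset inj); apply: subset_leq_card; apply/subsetP => _ /imsetP[v vP ->].
move: vP; rewrite !inE => /andP[/and3P[vO _ /andP[nk _]] vG]; rewrite nk andbT.
by apply: imset_f; rewrite inE vO.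
Qed.

Lemma picked_group_card_le k x (G : {set V}) : (#|picked k x :&: G| <= #|sl @: (O :&: G)|)%N.
Proof.
apply: leq_trans (picked_group_card k x G) _; apply: subset_leq_card.
by apply/subsetP => s; rewrite inE => /andP[].
Qed.

Lemma picked_group_card_sum x (G : {set V}) :
  (\sum_k #|picked k x :&: G| <= 2 * #|sl @: (O :&: G)|)%N.
Proof.
apply: (@leq_trans (\sum_k #|[set s in sl @: (O :&: G) | k != (x s).1.1]|)).
  by apply: leq_sum => k _; apply: picked_group_card.
under eq_bigr do rewrite -sum1_card.
rewrite (exchange_big_dep (mem (sl @: (O :&: G)))) /=; last by move=> k s _; rewrite inE => /andP[].
rewrite mulnC -sum_nat_const; apply: leq_sum => s sG.
rewrite (eq_bigl (mem [set~ (x s).1.1])) => [|k]; last by rewrite !inE sG.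
by rewrite sum1_card cardsC1 card_ord.
Qed.

End Coupling.

(** * Expected value of the greedy phase *)

Section ExpectedGreedy.
Variables (R : rcfType) (V I : finType) (m : nat) (g : V -> 'I_m) (p : R).
Variables (alpha : nat) (f : {set V} -> R).
Hypotheses (p_lo : 309%:R / 1000%:R <= p) (p_hi : p <= 31%:R / 100%:R).
Hypotheses (fsub : submodular f) (f_ge0 : nonneg f).
Hypothesis r_gt0 : forall i, (0 < rcap g alpha i)%N.
Variables (O : {set V}) (sl : V -> I) (ps : V -> 'I_3).
Hypothesis sl_ps_inj : {in O &, forall u v, sl u = sl v -> ps u = ps v -> u = v}.
Hypothesis slots_le : forall i, (#|sl @: (O :&: grp g i)| <= rcap g alpha i)%N.
Variables (A : {set V} -> {set V}) (d : {set V} -> V -> R) (dl : {set V} -> 'I_m -> R).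
Hypothesis Aprice : forall Rs, priced g alpha f Rs (A Rs) (d Rs) (dl Rs).

Let k1 : 'I_3 := ord0.
Let k2 : 'I_3 := lift ord0 ord0.
Let k3 : 'I_3 := lift ord0 (lift ord0 ord0).

Section FixedOutside.
Variable W : {set V}.
Hypothesis dOW : [disjoint O & W].

Let wt := @weight R V I p O sl ps.
Let smp (k : 'I_3) (x : coupling V I) := sample k x.
Let pk k x := picked O sl ps k x.
Let run (k : 'I_3) (x : coupling V I) := A (W :|: smp k x).

Let covered (x : coupling V I) : {set V} :=
  pk k1 x :|: pk k2 x :|: pk k3 x :|: (run k1 x :|: run k2 x :|: run k3 x) :&: O.

(** The selections alone suffice: an item lies in at most one of the three, and in each with
    probability 2/9. *)
Lemma covered_prob v : v \in O -> 2%:R / 3%:R <= \sum_(x | v \in covered x) wt x.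
Proof.
move=> vO; rewrite big_mkcond /=.
apply: (@le_trans _ _ (\sum_x wt x * ((v \in pk k1 x)%:R + (v \in pk k2 x)%:R + (v \in pk k3 x)%:R))).
  under eq_bigr do rewrite !mulrDr.
  rewrite !big_split /= !(picked_cover p_lo p_hi sl_ps_inj) //; lra.
apply: ler_sum => x _; have w0 : 0 <= wt x := weight_ge0 p_lo p_hi sl_ps_inj x.
have D k l : v \in pk k x -> v \in pk l x -> k = l by apply: picked_disjoint.
rewrite /covered [v \in _ :|: _]inE [v \in _ :|: pk k3 x]inE [v \in pk k1 x :|: _]inE.
have [h1|h1] := boolP (v \in pk k1 x).
  have -> : v \in pk k2 x = false by apply/negP => /(D _ _ h1).
  have -> : v \in pk k3 x = false by apply/negP => /(D _ _ h1).
  by rewrite !addr0 mulr1.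
have [h2|h2] := boolP (v \in pk k2 x).
  have -> : v \in pk k3 x = false by apply/negP => /(D _ _ h2).
  by rewrite add0r addr0 mulr1.
have [h3|h3] := boolP (v \in pk k3 x); first by rewrite !add0r mulr1.
by rewrite !addr0 mulr0; case: ifP.
Qed.

Let eS (S : {set V}) := f (A (W :|: S)).
Let outP (S : {set V}) := \sum_(a in A (W :|: S) :\: O) d (W :|: S) a.
Let inP (S : {set V}) := \sum_(a in A (W :|: S) :&: O) d (W :|: S) a.
Let inD (S : {set V}) := \sum_(a in A (W :|: S) :&: O) dl (W :|: S) (g a).
Let saved k x := \sum_(a in (run k x :&: O) :&: pk k x) dl (W :|: smp k x) (g a).

Lemma coupled_bound x : wt x != 0 ->
  fmin f O W (covered x) <=
  eS (smp k1 x) + (outP (smp k2 x) + inP (smp k2 x)) + inP (smp k3 x)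
  + (outP (smp k1 x) + (inD (smp k1 x) - saved k1 x))
  + (outP (smp k2 x) + (inD (smp k2 x) - saved k2 x))
  + (outP (smp k3 x) + (inD (smp k3 x) - saved k3 x)).
Proof.
move=> wx.
have sO k : smp k x \subset O := sample_sub k wx.
have sP k : pk k x \subset smp k x := picked_sub k wx.
have tr k i : (#|pk k x :&: grp g i| <= rcap g alpha i)%N.
  by apply: leq_trans (slots_le i); apply: picked_group_card_le.
have t3 i : (#|pk k1 x :&: grp g i| + #|pk k2 x :&: grp g i| + #|pk k3 x :&: grp g i|
             <= 2 * rcap g alpha i)%N.
  apply: leq_trans (leq_mul (leqnn 2) (slots_le i)).
  have := picked_group_card_sum sl_ps_inj x (grp g i).
  by rewrite !big_ord_recl big_ord0 addn0 addnA.
have := exchange_bound fsub r_gt0 dOW (sO k1) (sO k2) (sO k3) (sP k1) (sP k2) (sP k3)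
  (Aprice _) (Aprice _) (Aprice _) (tr k1) (tr k2) (tr k3) t3.
have split_in k : \sum_(a in run k x :&: O) dl (W :|: smp k x) (g a) =
   saved k x + \sum_(a in (run k x :&: O) :\: pk k x) dl (W :|: smp k x) (g a).
  by rewrite (big_setID (pk k x)).
have split_run k : \sum_(a in run k x) d (W :|: smp k x) a =
   inP (smp k x) + outP (smp k x) by rewrite (big_setID O).
rewrite -/(run k1 x) -/(run k2 x) -/(run k3 x) split_run.
have q1 := split_in k1; have q2 := split_in k2; have q3 := split_in k3.
rewrite -/(inD _) in q1; rewrite -/(inD _) in q2; rewrite -/(inD _) in q3.
rewrite -!/(outP _) -!/(inP _) -!/(eS _) => h.
have le_f : fmin f O W (covered x) <=
    f (run k1 x :|: run k2 x :|: run k3 x :|: pk k1 x :|: pk k2 x :|: pk k3 x).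
  (* Outside [O] the three runs pick from [W] only, so these picks are a candidate in the minimum
     defining [fmin]. *)
  have sub : (run k1 x :|: run k2 x :|: run k3 x) :\: O \subset W.
    apply/subsetP => v; rewrite !inE => /andP[vO].
    have runW k : v \in run k x -> v \in W.
      have [sA _ _ _ _] := Aprice (W :|: smp k x).
      move=> /(subsetP sA); rewrite inE => /orP[//|/(subsetP (sO k))].
      by rewrite (negbTE vO).
    by case/orP => [/orP[]|]; apply: runW.
  apply: le_trans (fmin_le f O (covered x) sub) _.
  rewrite le_eqVlt; apply/orP; left; apply/eqP; congr f; apply/setP => v.
  rewrite /covered !inE -!/(pk _ _).
  have pO k : v \in pk k x -> v \in O by apply: (subsetP (picked_subO O sl ps k x)).
  have := pO k1; have := pO k2; have := pO k3; rewrite /pk !inE -!/(pk _ _).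
  case: (v \in O) => /=; last first.
    by rewrite !andbF !orbF.
  by move=> _ _ _; rewrite !andbT orbF orbC !orbA.
apply: le_trans le_f _; apply: le_trans h _; rewrite /eS /run in q1 q2 q3 *.
lra.
Qed.

(** For each item [a], the price paid if greedy picks [a] is a function of the sample, so
    [picked_share] applies item by item. *)
Lemma saved_expect k :
  33%:R / 100%:R * \sum_(S : {set V} | S \subset O) bern p O S * inD S <=
  \sum_x wt x * saved k x.
Proof.
pose psi a (S : {set V}) := if a \in A (W :|: S) then dl (W :|: S) (g a) else 0.
have psi0 a S : 0 <= psi a S.
  by rewrite /psi; case: ifP => // _; have [_ _ _ _ [_ h _ _ _]] := Aprice (W :|: S).
have L : \sum_x wt x * saved k x =
    \sum_(a in O) \sum_x wt x * (psi a (smp k x) * (a \in pk k x)%:R).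
  rewrite exchange_big /=; apply: eq_bigr => x _; rewrite -mulr_sumr; congr (_ * _).
  rewrite /saved big_mkcond [RHS]big_mkcond; apply: eq_bigr => a _.
  rewrite in_setI [a \in _ :&: O]in_setI /run /psi.
  by case: (a \in O); case: (a \in A _); case: (a \in pk _ _);
    rewrite ?mulr1 ?mulr0 ?mul0r.
have RR : \sum_(S : {set V} | S \subset O) bern p O S * inD S =
    \sum_(a in O) \sum_(S : {set V} | S \subset O) bern p O S * (psi a S * (a \in S)%:R).
  rewrite exchange_big /=; apply: eq_bigr => S sSO; rewrite -mulr_sumr; congr (_ * _).
  rewrite /inD big_mkcond [RHS]big_mkcond; apply: eq_bigr => a _.
  rewrite in_setI /psi; have [sA _ _ _ _] := Aprice (W :|: S).
  have [aO|_] := boolP (a \in O); rewrite ?andbF // andbT.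
  case: ifP => [aA|_]; last by rewrite mul0r.
  move: (subsetP sA a aA); rewrite inE (disjointFr dOW aO) /= => ->.
  by rewrite mulr1.
rewrite L RR mulr_sumr; apply: ler_sum => a aO.
exact: (picked_share p_lo p_hi sl_ps_inj).
Qed.

(* 501/100 = 6 - 3 * 33/100, where 33/100 comes from [picked_share]. *)
Lemma greedy_expect_fixed :
  2%:R / 3%:R * fmin f O W O <=
  501%:R / 100%:R * \sum_(S : {set V} | S \subset O) bern p O S * f (A (W :|: S)).
Proof.
have w0 x : 0 <= wt x := weight_ge0 p_lo p_hi sl_ps_inj x.
have cO x : covered x \subset O.
  by rewrite !subUset !picked_subO /= subsetIr.
have q1 : 2%:R / 3%:R <= 1 :> R by lra.
have hmin0 : nonneg (fmin f O W) by move=> S; apply: f_ge0.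
have := random_set_covers w0 (weight_total p_lo p_hi sl_ps_inj) (fmin_submodular fsub dOW)
  hmin0 q1 cO covered_prob.
move=> /le_trans; apply.
pose U x := eS (smp k1 x) + (outP (smp k2 x) + inP (smp k2 x)) + inP (smp k3 x)
  + (outP (smp k1 x) + (inD (smp k1 x) - saved k1 x))
  + (outP (smp k2 x) + (inD (smp k2 x) - saved k2 x))
  + (outP (smp k3 x) + (inD (smp k3 x) - saved k3 x)).
apply: (@le_trans _ _ (\sum_x wt x * U x)).
  apply: ler_sum => x _; have [->|wx] := eqVneq (wt x) 0; first by rewrite !mul0r.
  by rewrite ler_wpM2l // coupled_bound.
have law k Phi : \sum_x wt x * Phi (smp k x) =
    \sum_(S : {set V} | S \subset O) bern p O S * Phi S.
  exact: (sample_law p_lo p_hi sl_ps_inj).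
have s1 := saved_expect k1; have s2 := saved_expect k2; have s3 := saved_expect k3.
have -> : \sum_x wt x * U x =
   \sum_x wt x * eS (smp k1 x) + (\sum_x wt x * outP (smp k2 x) + \sum_x wt x * inP (smp k2 x))
   + \sum_x wt x * inP (smp k3 x)
   + (\sum_x wt x * outP (smp k1 x) + (\sum_x wt x * inD (smp k1 x) - \sum_x wt x * saved k1 x))
   + (\sum_x wt x * outP (smp k2 x) + (\sum_x wt x * inD (smp k2 x) - \sum_x wt x * saved k2 x))
   + (\sum_x wt x * outP (smp k3 x) + (\sum_x wt x * inD (smp k3 x) - \sum_x wt x * saved k3 x)).
  rewrite -!sumrB -!big_split /=; apply: eq_bigr => x _; rewrite /U.
  by rewrite !mulrDr !mulrN.
rewrite !law.
have bn S : 0 <= bern p O S.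
  by apply: bern_ge0; [apply: le_trans p_lo; lra | apply: le_trans p_hi _; lra].
have DQ : \sum_(S : {set V} | S \subset O) bern p O S * inD S <=
          \sum_(S : {set V} | S \subset O) bern p O S * inP S.
  apply: ler_sum => S _; rewrite ler_wpM2l //; apply: ler_sum => a.
  have [_ _ _ _ [_ _ h _ _]] := Aprice (W :|: S).
  by rewrite inE => /andP[aA _]; apply: h.
have PQ : \sum_(S : {set V} | S \subset O) bern p O S * outP S +
          \sum_(S : {set V} | S \subset O) bern p O S * inP S <=
          \sum_(S : {set V} | S \subset O) bern p O S * eS S.
  rewrite -big_split /=; apply: ler_sum => S _; rewrite -mulrDr ler_wpM2l //.
  have [_ _ h _ _] := Aprice (W :|: S); rewrite /eS h (big_setID O) /= addrC.
  by rewrite lerDr.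
have P0 : 0 <= \sum_(S : {set V} | S \subset O) bern p O S * outP S.
  apply: sumr_ge0 => S _; rewrite mulr_ge0 // sumr_ge0 // => a _.
  by have [_ _ _ _ [h _ _ _ _]] := Aprice (W :|: S).
(* In expectation the bound is at most [eS + 4 outP + 2 inP + 2.01 inD]. Replacing [inD] by [inP]
   and using [outP + inP <= eS] gives 5.01. *)
move: DQ PQ P0 s1 s2 s3; rewrite -!/(eS _).
lra.
Qed.

End FixedOutside.

Lemma fmin_expect :
  (1 - p) * f O <= \sum_(W : {set V} | W \subset ~: O) bern p (~: O) W * fmin f O W O.
Proof.
have p0 : 0 <= p by apply: le_trans p_lo; lra.
have p1 : p <= 1 by apply: le_trans p_hi _; lra.
pose mu (W : {set V}) := if W \subset ~: O then bern p (~: O) W else 0.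
have mu0 W : 0 <= mu W by rewrite /mu; case: ifP => // _; apply: bern_ge0.
have mu1 : \sum_W mu W = 1 by rewrite -big_mkcond bern_total.
have hsub : submodular (fun S => f (O :|: S)).
  move=> X Y sXY e eY; rewrite !(setUCA O).
  have [eO|eO] := boolP (e \in O); last by apply: fsub; [apply: setUS | rewrite inE negb_or eO].
  have eU S : e |: (O :|: S) = O :|: S by apply/setUidPr; rewrite sub1set inE eO.
  by rewrite !eU !subrr.
have h0 : nonneg (fun S => f (O :|: S)) by move=> S; apply: f_ge0.
have marg v : \sum_(W | v \in best_in f O W O) mu W <= p.
  have le1 : \sum_(W | v \in best_in f O W O) mu W <= \sum_(W : {set V} | v \in W) mu W.
    rewrite big_mkcond [X in _ <= X]big_mkcond; apply: ler_sum => W _.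
    by case: ifP => [/(subsetP (best_in_sub f O W O))->|_] //; case: ifP.
  apply: le_trans le1 _; rewrite -big_mkcondr.
  have [vO|vO] := boolP (v \in ~: O).
    by rewrite -[X in _ <= X](bern_marginal p vO) le_eqVlt (eq_bigl _ _ (fun W => andbC _ _)) eqxx.
  rewrite big1 // => W /andP[vW sW]; by rewrite (subsetP sW) in vO.
have := random_set_avoids mu0 mu1 hsub h0 p0 marg.
rewrite setU0 => /le_trans; apply; rewrite [X in _ <= X]big_mkcond.
apply: ler_sum => W _; rewrite /mu /fmin setIid; case: ifP => // _; by rewrite mul0r.
Qed.

Lemma greedy_expect :
  2%:R / 3%:R * (1 - p) * f O <= 501%:R / 100%:R * expect_sample p (fun Rs => f (A Rs)).
Proof.
rewrite (expect_sample_split p O) mulr_sumr -mulrA.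
have h : 2%:R / 3%:R * ((1 - p) * f O) <= 2%:R / 3%:R *
    \sum_(W : {set V} | W \subset ~: O) bern p (~: O) W * fmin f O W O.
  by rewrite ler_wpM2l ?fmin_expect // divr_ge0 ?ler0n.
apply: le_trans h _; rewrite mulr_sumr; apply: ler_sum => W sW.
rewrite mulrCA [X in _ <= X]mulrCA ler_wpM2l //.
  by apply: bern_ge0; [apply: le_trans p_lo; lra | apply: le_trans p_hi _; lra].
apply: greedy_expect_fixed.
by rewrite disjoint_sym disjoints_subset.
Qed.

End ExpectedGreedy.

(** * Slots, completion and conclusion *)

Section Capacities.
Variables (V : finType) (m : nat) (g : V -> 'I_m) (alpha : nat).

Lemma kmin_le i : (kmin g <= ksz g i)%N.
Proof.
rewrite /kmin; elim: (index_enum _) (mem_index_enum i) => // j s IH.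
rewrite big_cons inE => /predU1P[->|/IH]; first exact: geq_minl.
by apply: leq_trans; apply: geq_minr.
Qed.

Lemma rcap_gt0 i : (1 < kmin g)%N -> (0 < rcap g alpha i)%N.
Proof. by have := kmin_le i; rewrite /rcap; lia. Qed.

(** The size is at most [ksz g i] and at most [kmin g + alpha], and a third of an integer above 1 is
    at most its half rounded down. *)
Lemma feasible_card_le (O : {set V}) i :
  feasible g alpha O -> (1 < kmin g)%N -> (#|O :&: grp g i| <= 3 * rcap g alpha i)%N.
Proof.
move=> feas kmin1.
have le_grp : (#|O :&: grp g i| <= ksz g i)%N by rewrite subset_leq_card // subsetIr.
have le_kmin : (#|O :&: grp g i| <= kmin g + alpha)%N.
  rewrite /kmin; elim/big_ind: _ => [|a b ha hb|j _].
  (* The default value [#|V|] of the minimum. *)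
  - by apply: leq_trans (max_card _) (leq_addr _ _).
  - by rewrite /minn; case: ifP.
  have := feas i j; have : (#|O :&: grp g j| <= ksz g j)%N by rewrite subset_leq_card // subsetIr.
  lia.
have := kmin_le i; rewrite /rcap; lia.
Qed.

(** Each group of [O] is enumerated; the rank divided by 3 names the slot and the remainder the
    position. Quotients stay below [#|V|.+1], so [inord] is faithful on them. *)
Lemma slots_exist (O : {set V}) (r : 'I_m -> nat) :
  (forall i, #|O :&: grp g i| <= 3 * r i)%N ->
  exists (sl : V -> 'I_m * 'I_(#|V|.+1)) (ps : V -> 'I_3),
    {in O &, forall u v, sl u = sl v -> ps u = ps v -> u = v} /\
    (forall i, #|sl @: (O :&: grp g i)| <= r i)%N.
Proof.
move=> leO; pose rk v := index v (enum (O :&: grp g (g v))).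
have rk_lt v : v \in O -> (rk v < #|O :&: grp g (g v)|)%N.
  by move=> vO; rewrite cardE index_mem mem_enum !inE vO eqxx.
have rkV v : v \in O -> (rk v %/ 3 < #|V|.+1)%N.
  move=> vO; rewrite ltnS; apply: leq_trans (leq_div _ _) _; apply: leq_trans (max_card _).
  exact: ltnW (rk_lt v vO).
exists (fun v => (g v, inord (rk v %/ 3))), (fun v => inord (rk v %% 3)).
split=> [u v uO vO e1 /(congr1 val)/= r3|i].
  have /= guv := congr1 fst e1; have /= q := congr1 (fun z => val z.2) e1.
  move: q r3; rewrite !inordK ?rkV ?ltn_mod // => q r3.
  have : rk u = rk v by rewrite (divn_eq (rk u) 3) (divn_eq (rk v) 3) q r3.
  rewrite /rk guv => e.
  have uG : u \in enum (O :&: grp g (g v)) by rewrite mem_enum !inE uO guv eqxx.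
  have vG : v \in enum (O :&: grp g (g v)) by rewrite mem_enum !inE vO eqxx.
  by rewrite -[LHS](nth_index u uG) e nth_index.
pose slot_of (l : 'I_(r i)) : 'I_m * 'I_(#|V|.+1) := (i, inord l).
apply: (@leq_trans #|slot_of @: [set: 'I_(r i)]|); last first.
  by apply: leq_trans (leq_imset_card _ _) _; rewrite cardsT card_ord.
apply: subset_leq_card; apply/subsetP => s /imsetP[v]; rewrite !inE => /andP[vO /eqP gv] ->.
have lt : (rk v %/ 3 < r i)%N.
  by rewrite ltn_divLR // mulnC; apply: leq_trans (rk_lt v vO) _; rewrite gv.
by apply/imsetP; exists (Ordinal lt); rewrite // /slot_of gv.
Qed.

End Capacities.

(** The two completions meet exactly in [Ag], so submodularity and nonnegativity give
    [f Ag <= f A1 + f A2]. *)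
Lemma completion_half (R : rcfType) (V : finType) (m : nat) (g : V -> 'I_m) (alpha : nat)
    (f : {set V} -> R) (Rs Af : {set V}) :
  submodular f -> nonneg f -> SG_out g alpha f Rs Af ->
  exists2 Ag, greedy_out g alpha f Rs Ag & f Ag <= 2%:R * f Af.
Proof.
move=> fsub f0 [Ag [X [Y [gAg XY]]]] /=.
set A1 := Ag :|: _; set A2 := Ag :|: _ => best; exists Ag => //.
have A12 : A1 :&: A2 = Ag.
  rewrite -setUIr; apply/setUidPl/subsetP => v; rewrite inE => /andP[].
  move=> /bigcupP[i li vX] /bigcupP[j lj vY].
  have [sX _ dXY _ _] := XY i li; have [_ sY _ _ _] := XY j lj.
  move: (subsetP sX v vX) (subsetP sY v vY); rewrite !inE => /andP[_ /eqP gi] /andP[_ /eqP gj].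
  by move: vY; rewrite -gj gi (disjointFr dXY vX).
have := submodularUI fsub A1 A2; rewrite A12.
have := f0 (A1 :|: A2); case: best => -[-> le]; lra.
Qed.

Theorem theorem1 (R : rcfType) (V : finType) (m : nat) (g : V -> 'I_m)
    (alpha : nat) (f : {set V} -> R) (OPT : {set V})
    (out : {set V} -> {set V}) :
  (0 < m)%N ->
  nonneg f ->
  submodular f ->
  feasible g alpha OPT ->
  (forall S, feasible g alpha S -> f S <= f OPT) ->
  (1 < kmin g)%N ->
  (forall Rs, SG_out g alpha f Rs (out Rs)) ->
  expect_sample ((Num.sqrt 5 - 1) / 4) (fun Rs => f (out Rs))
    >= (45%:R / 1000%:R) * f OPT.
Proof.
move=> _ f0 fsub feas _ kmin1 outP.
set p := (Num.sqrt 5 - 1) / 4.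
have sq5 : Num.sqrt 5 ^+ 2 = 5 :> R by rewrite sqr_sqrtr.
have sq0 : 0 <= Num.sqrt 5 :> R := sqrtr_ge0 5.
have p_lo : 309%:R / 1000%:R <= p.
  rewrite /p; move: (Num.sqrt 5) sq5 sq0 => s; rewrite expr2; nra.
have p_hi : p <= 31%:R / 100%:R.
  rewrite /p; move: (Num.sqrt 5) sq5 sq0 => s; rewrite expr2; nra.
(* One greedy output is fixed for each sample, with no relation between different samples. *)
have /fin_all_exists[A AP] : forall Rs : {set V}, exists Ag,
    greedy_out g alpha f Rs Ag /\ f Ag <= 2%:R * f (out Rs).
  by move=> Rs; have [Ag h1 h2] := completion_half fsub f0 (outP Rs); exists Ag.
have r0 i : (0 < rcap g alpha i)%N by apply: rcap_gt0.
have /fin_all_exists[d dP] Rs := greedy_out_priced fsub r0 (proj1 (AP Rs)).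
have {dP}/fin_all_exists[dl dP] := dP.
have [sl [ps [inj slots]]] := slots_exist (fun i => feasible_card_le i feas kmin1).
have main := greedy_expect p_lo p_hi fsub f0 r0 inj slots dP.
have half : expect_sample p (fun Rs => f (A Rs)) <=
    2%:R * expect_sample p (fun Rs => f (out Rs)).
  rewrite /expect_sample mulr_sumr; apply: ler_sum => Rs _.
  rewrite mulrCA ler_wpM2l ?(proj2 (AP Rs)) // mulr_ge0 // exprn_ge0 //; lra.
(* With [p <= 0.31] the factor is at least 2/3 times 0.69 divided by 10.02, about 0.0459. *)
have := f0 OPT; move: main half p_hi; clear; nra.
Qed.
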